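(* Let $k=\mathbb{F}_q$ be a finite field of characteristic $p$, let $\varphi$ be Euler's totient function and let $P$ be any point of degree two in $\mathbb{P}^1(\bar k)$. For every $n\ge0$ the number $t_1(n)$ splits as $$t_1(n)=t_{1,A}(n)+t_{1,B}(n)+t_{1,C}(n)+t_{1,D}(n),$$ each term having the following generating function: $$\sum_{n\ge0}t_{1,A}(n)x^n=\frac{1+x^2}{2(q+1)}\sum_{d\mid q+1,\,d>1}\varphi(d)\,f_{\mathbb{P}^1\setminus O_\sigma(P)}(x^d),$$ $$\sum_{n\ge0}t_{1,B}(n)x^n=\frac{1+x}{q}\,f_{\mathbb{A}^1}(x^p),$$ $$\sum_{n\ge0}t_{1,C}(n)x^n=\frac{(1+x)^2}{2(q-1)}\sum_{d\mid q-1,\,d>1}\varphi(d)\,f_{\mathbb{A}^1\setminus\{\ast\}}(x^d),$$ $$\sum_{n\ge0}t_{1,D}(n)x^n=\frac{1}{q(q-1)(q+1)}\,f_{\mathbb{P}^1}(x).$$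
   Context: Let $\bar k$ be an algebraic closure of $k=\mathbb{F}_q$ and $\sigma$ the $q$-Frobenius. A rational $n$-set of $\mathbb{P}^1$ is an $n$-element subset of $\mathbb{P}^1(\bar k)$ stable under $\sigma$; $t_1(n)$ is the number of orbits of $\Gamma=\mathrm{PGL}_2(k)$ on the set of rational $n$-sets of $\mathbb{P}^1$. For a quasiprojective variety $V$ over $k$, $f_V(x)=\sum_{n\ge0}a_V(n)x^n$, where $a_V(n)$ is the number of $\sigma$-stable $n$-element subsets of $V(\bar k)$ ($a_V(0)=1$). The symbol $\ast$ denotes a $k$-rational point; $O_\sigma(P)$ is the $\sigma$-orbit of $P$; the degree of a point is the length of its $\sigma$-orbit. The splitting is according to the type of elements of $\Gamma$. For $T\in\{A,B,C,D\}$, $$t_{1,T}(n)=\sum_{\gamma\in\mathcal{C},\ \gamma\text{ of type }T}|\Gamma_\gamma|^{-1}\cdot|\{S \text{ rational } n\text{-set of }\mathbb{P}^1: \gamma(S)=S\}|,$$ where $\mathcal{C}$ is a set of representatives of conjugacy classes of $\Gamma$ and $\Gamma_\gamma$ is the centralizer of $\gamma$ in $\Gamma$. The types of $\gamma\in\mathrm{PGL}_2(k)$, in terms of a representing matrix in $\mathrm{GL}_2(k)$, are: A: irreducible characteristic polynomial over $k$; B: non-diagonalizable with a single eigenvalue (in $k$); C: two distinct eigenvalues in $k$; D: scalar (i.e. $\gamma=1$). *)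

(* Defs.v *)
From HB Require Import structures.
From mathcomp Require Import all_boot all_order all_fingroup all_algebra.
From mathcomp Require Import all_field finmap.
From mathcomp Require Import boolp classical_sets functions cardinality.

Set Implicit Arguments.
Unset Strict Implicit.
Unset Printing Implicit Defensive.

Import GRing.Theory.
Local Open Scope ring_scope.

(** [fset_set] returns the empty set on infinite sets, so [card] is only
    meaningful on finite ones.  Over an algebraic closure of a finite field all
    sets counted below are finite: Frobenius orbits of points are, and a stable
    n-element set consists of points of degree at most n. *)
Definition card (T : choiceType) (A : set T) : nat := #|` fset_set A|.

(** The [n]-element Frobenius-stable subsets of [V], where [V] is a set of
    geometric points in an ambient set [T] with Frobenius [sigma]. *)
Definition rational_subsets (T : choiceType) (sigma : T -> T) (V : set T)
    (n : nat) : set {fset T} :=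
  [set S : {fset T} | [/\ #|` S| = n, (forall x, x \in S -> V x)
                        & [fset sigma x | x in S]%fset = S]]%classic.

(** Formal power series over [rat], as coefficient sequences.  Sums are the
    pointwise ones on [nat -> rat]; the product is Cauchy's. *)
Notation fps := (nat -> rat).

Definition fps_scale (c : rat) (f : fps) : fps := fun n => c * f n.

Definition fps_mul (u v : fps) : fps :=
  fun n => \sum_(i < n.+1) u i * v (n - i)%N.

Definition fps_poly (P : {poly rat}) : fps := fun n => P`_n.

(** [fps_dil d f] is f(x^d), for [0 < d]. *)
Definition fps_dil (d : nat) (f : fps) : fps :=
  fun n => if (d %| n)%N then f (n %/ d)%N else 0.

(** f_V(x), where [V] is the set of geometric points of the variety. *)
Definition fV (T : choiceType) (sigma : T -> T) (V : set T) : fps :=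
  fun n => (card (rational_subsets sigma V n))%:R.

(** Points are lines of column vectors, so matrices act on the left. *)
Definition P1 (K : fieldType) : choiceType :=
  {L : {vspace 'cV[K]_2} | \dim L == 1%N}.

Lemma P1_of_subproof (K : fieldType) (v : 'cV[K]_2) :
  v != 0 -> \dim <[v]> == 1%N.
Proof. by move=> v0; rewrite dim_vline v0. Qed.

Definition P1_of (K : fieldType) (v : 'cV[K]_2) (v0 : v != 0) : P1 K :=
  exist _ <[v]>%VS (P1_of_subproof v0).

Lemma P1_vpick (K : fieldType) (x : P1 K) : vpick (val x) != 0.
Proof. by rewrite vpick0 -dimv_eq0 (eqP (valP x)). Qed.

Lemma P1_of_eqP (K : fieldType) (v w : 'cV[K]_2) (v0 : v != 0) (w0 : w != 0) :
  (exists c : K, v = c *: w) -> P1_of v0 = P1_of w0.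
Proof.
case=> c vE; apply/val_inj/eqP; rewrite eqEdim !dim_vline v0 w0 leqnn andbT.
by rewrite -memvE vE memvZ ?memv_line.
Qed.

Lemma P1_of_vpick (K : fieldType) (v : 'cV[K]_2) (v0 : v != 0) :
  exists c : K, vpick (val (P1_of v0)) = c *: v.
Proof. exact/vlineP/memv_pick. Qed.

Definition frob (k : finFieldType) (K : fieldType) (a : K) : K := a ^+ #|k|.

Lemma frob_neq0 (k : finFieldType) (K : fieldType) (v : 'cV[K]_2) :
  v != 0 -> map_mx (@frob k K) v != 0.
Proof.
apply: contraNneq => /matrixP h; apply/eqP/matrixP => i j.
have := h i j; rewrite !mxE /frob => /eqP; rewrite expf_eq0.
by case/andP=> _ /eqP.
Qed.

Definition frobP1 (k : finFieldType) (K : fieldType) (x : P1 K) : P1 K :=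
  P1_of (frob_neq0 k (P1_vpick x)).

Lemma frobP1_of (k : finFieldType) (K : fieldType) (v : 'cV[K]_2) (v0 : v != 0) :
  frobP1 k (P1_of v0) = P1_of (frob_neq0 k v0).
Proof.
apply: P1_of_eqP; have [c ->] := P1_of_vpick v0; exists (frob k c).
by apply/matrixP=> i j; rewrite !mxE /frob exprMn.
Qed.

Definition frob_orbit (k : finFieldType) (K : fieldType) (x : P1 K) :
    set (P1 K) :=
  [set y | exists i : nat, y = iter i (@frobP1 k K) x]%classic.

Definition degree (k : finFieldType) (K : fieldType) (x : P1 K) : nat :=
  card (frob_orbit k x).

Definition scalars (k : finFieldType) : {set {'GL_2[k]}} :=
  [set g | is_scalar_mx (GLval g)].

Lemma scalars_group_set (k : finFieldType) : group_set (scalars k).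
Proof.
apply/group_setP; split=> [|g h].
  by rewrite inE GL_1E scalar_mx_is_scalar.
rewrite !inE GL_ME => /is_scalar_mxP[a ->] /is_scalar_mxP[b ->].
by apply/is_scalar_mxP; exists (a * b); exact/esym/scalar_mxM.
Qed.

Canonical scalars_group (k : finFieldType) := Group (scalars_group_set k).

Definition PGL2T (k : finFieldType) : finGroupType := coset_of (scalars k).

Definition PGL2 (k : finFieldType) : {group PGL2T k} :=
  ('GL_2[k] / scalars k)%G.

Lemma GL2_act_neq0 (k : finFieldType) (K : fieldType) (iota : {rmorphism k -> K})
    (g : {'GL_2[k]}) (v : 'cV[K]_2) :
  v != 0 -> map_mx iota (GLval g) *m v != 0.
Proof.
have /mulKmx gK : map_mx iota (GLval g) \in unitmx by rewrite map_unitmx GL_unitmx.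
by apply: contraNneq => gv0; rewrite -[v](gK _) gv0 mulmx0.
Qed.

Definition GL2_act (k : finFieldType) (K : fieldType) (iota : {rmorphism k -> K})
    (g : {'GL_2[k]}) (x : P1 K) : P1 K :=
  P1_of (GL2_act_neq0 iota g (P1_vpick x)).

Definition PGL2_act (k : finFieldType) (K : fieldType) (iota : {rmorphism k -> K})
    (gamma : PGL2T k) (x : P1 K) : P1 K :=
  GL2_act iota (repr gamma) x.

Definition PGL2_image (k : finFieldType) (K : fieldType)
    (iota : {rmorphism k -> K}) (gamma : PGL2T k) (S : {fset P1 K}) :
    {fset P1 K} :=
  [fset PGL2_act iota gamma x | x in S]%fset.

Lemma GL2_act_of (k : finFieldType) (K : fieldType) (iota : {rmorphism k -> K})
    (g : {'GL_2[k]}) (v : 'cV[K]_2) (v0 : v != 0) :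
  GL2_act iota g (P1_of v0) = P1_of (GL2_act_neq0 iota g v0).
Proof.
apply: P1_of_eqP; have [c ->] := P1_of_vpick v0; exists c.
by rewrite -scalemxAr.
Qed.

Lemma norm_scalars (k : finFieldType) (g : {'GL_2[k]}) :
  g \in 'N(scalars k)%g.
Proof.
apply: (fintype.subsetP (cent_sub _)); apply/centP=> h; rewrite inE => /is_scalar_mxP[a hE].
apply/val_inj; change (GLval (g * h)%g = GLval (h * g)%g).
by rewrite !GL_ME hE -!mulmxE scalar_mxC.
Qed.

Lemma PGL2E (k : finFieldType) : PGL2 k = [set: PGL2T k]%G.
Proof.
apply/val_inj/setP=> x; rewrite [RHS]inE; have [g _ ->] := cosetP x.
by rewrite mem_quotient // inE.
Qed.

Lemma PGL2_act_coset (k : finFieldType) (K : fieldType)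
    (iota : {rmorphism k -> K}) (g : {'GL_2[k]}) (x : P1 K) :
  PGL2_act iota (coset (scalars k) g) x = GL2_act iota g x.
Proof.
rewrite /PGL2_act; have := mem_repr_coset (coset (scalars k) g).
rewrite val_coset ?norm_scalars // => /rcosetP[h].
rewrite inE => /is_scalar_mxP[a hE] ->.
apply: P1_of_eqP; exists (iota a).
by rewrite GL_ME hE map_mxM map_scalar_mx -mulmxA mul_scalar_mx.
Qed.

Definition rational_nsets (k : finFieldType) (K : fieldType) (n : nat) :
    set {fset P1 K} :=
  rational_subsets (@frobP1 k K) [set: P1 K]%classic n.

Definition PGL2_orbit (k : finFieldType) (K : fieldType)
    (iota : {rmorphism k -> K}) (S : {fset P1 K}) : set {fset P1 K} :=
  [set S' | exists2 gamma, gamma \in PGL2 k & S' = PGL2_image iota gamma S]%classic.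

Definition t1 (k : finFieldType) (K : fieldType) (iota : {rmorphism k -> K})
    (n : nat) : nat :=
  card [set O : set {fset P1 K} |
         exists2 S, rational_nsets k n S & O = PGL2_orbit iota S]%classic.

(** Types of elements of PGL_2(k), read off a representing matrix. *)
Inductive elt_type := TypeA | TypeB | TypeC | TypeD.

Definition mx_has_type (k : fieldType) (T : elt_type) (M : 'M[k]_2) : Prop :=
  match T with
  | TypeA => irreducible_poly (char_poly M)
  | TypeB => ~ diagonalizable M /\
             exists a, forall b, eigenvalue M b <-> b = a
  | TypeC => exists a b, [/\ a != b, eigenvalue M a & eigenvalue M b]
  | TypeD => is_scalar_mx M
  end.

Definition has_type (k : finFieldType) (T : elt_type) (gamma : PGL2T k) : Prop :=
  exists2 g : {'GL_2[k]}, coset (scalars k) g = gamma & mx_has_type T (GLval g).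

(** t_{1,T}(n), computed with the set [C] of class representatives. *)
Definition t1T (k : finFieldType) (K : fieldType) (iota : {rmorphism k -> K})
    (C : {set PGL2T k}) (T : elt_type) : fps :=
  fun n => \sum_(gamma in C | `[< has_type T gamma >])
    (#|'C_(PGL2 k)[gamma]%g|%:R)^-1 *
    (card [set S | rational_nsets k n S /\ PGL2_image iota gamma S = S]%classic)%:R.

(* Main.v *)
Require Import Defs.
From HB Require Import structures.
From mathcomp Require Import all_solvable ring zify.
From mathcomp Require Import all_boot all_order all_fingroup all_algebra.
From mathcomp Require Import all_field finmap.
From mathcomp Require Import boolp classical_sets functions cardinality.
Import GRing.Theory.
Local Open Scope ring_scope.

Set Implicit Arguments.
Unset Strict Implicit.
Unset Printing Implicit Defensive.

(** By Burnside's lemma [t_1(n)] is the average over [Gamma] of the number of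
    rational [n]-sets fixed by [gamma], and this average can be taken over
    [GL_2(k)].  For [g] of type A or C, an eigenbasis over [bar k] identifies
    P^1 minus the two fixed points of [g] with [bar k^*], where [g] acts as
    multiplication by a primitive [d]-th root of unity and Frobenius as
    [z |-> z^q] (type C) or [z |-> z^-q] (type A); fixed sets avoiding these two
    points are the pull-backs of rational sets under [z |-> z^d], and the points
    themselves contribute [(1+x)^2] or [1+x^2].  Type B is the same with the
    affine line, the translation [z |-> z+1] and the map [z |-> z^p - z].
    It remains to count the matrices with a given [d].  Those with given trace
    [t] and determinant [m] number [q(q-1) + q r], where [r] is the number of
    roots of [X^2 - t X + m] in [k], so one sums over the eigenvalues instead:
    powers of a primitive root of [k^*] for type C, and powers of a primitive
    [(q^2-1)]-th root of unity for type A, each matrix being counted twice. *)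

(** * Stable finite subsets *)

(** The constants arise as follows. GL_2(k) has q(q-1)^2(q+1) elements. Two distinct eigenvalues in
    k are shared by q(q+1) matrices, two conjugate ones outside k by q(q-1), a double eigenvalue by
    q^2-1 non-scalar ones. In type C an ordered pair of eigenvalues is (b, b y^i), which leaves q-1
    choices of b for each ratio y^i; in type A the exponents j < q^2-1 run q-1 times through the
    residues modulo q+1, and only the residue determines the ratio of the eigenvalues. Dividing by
    the group order, and by 2 where pairs are ordered, gives 1/(2(q-1)), 1/(2(q+1)) and 1/q.

    Work is done in GL_2(k) because trace and determinant are not defined on Gamma. In type A the
    obstacle is that no eigenvector is rational: Frobenius exchanges the two eigenlines, which
    inverts the coordinate z and turns z^q into z^-q. The quotient arguments are therefore stated
    for an abstract map in place of Frobenius, so that both forms of the multiplicative group are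
    treated at once. *)

Lemma card_infinite (T : choiceType) (A : set T) :
  ~ finite_set A -> Defs.card A = 0%N.
Proof.
by move=> Ai; rewrite /Defs.card /fset_set; case: pselect => // _; rewrite cardfs0.
Qed.

(** No finiteness is assumed: an injective image of an infinite set is infinite, and [card] is 0 on
    both. *)
Lemma card_bij (T1 T2 : choiceType) (f : T1 -> T2) (A : set T1) (B : set T2) :
  {in A &, injective f} -> (f @` A)%classic = B -> Defs.card A = Defs.card B.
Proof.
move=> fI <-; have [Af|Ai] := asboolP (finite_set A); last first.
  by rewrite !card_infinite // => fAf; apply: Ai; rewrite -(eq_finite_set (inj_card_eq fI)).
rewrite /Defs.card fset_set_image // card_in_imfset //= => x y.
by rewrite !in_fset_set // => xA yA; exact: fI.
Qed.

Lemma fset_stable_mem (T : choiceType) (f : T -> T) (S : {fset T}) x :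
  [fset f x | x in S]%fset = S -> x \in S -> f x \in S.
Proof. by move=> {2}<- xS; rewrite in_imfset. Qed.

(** Mapping [S] into itself suffices, because an injection of a finite set into itself is onto. *)
Lemma fset_stableP (T : choiceType) (f : T -> T) (S : {fset T}) :
  {in S &, injective f} -> (forall x, x \in S -> f x \in S) ->
  [fset f x | x in S]%fset = S.
Proof.
move=> fI fS; apply/eqP; rewrite eqEfcard card_in_imfset //= leqnn andbT.
by apply/fsubsetP => _ /imfsetP[x /= xS ->]; exact: fS.
Qed.

Lemma fset_stable_iter (T : choiceType) (f : T -> T) (S : {fset T}) x i :
  [fset f x | x in S]%fset = S -> x \in S -> iter i f x \in S.
Proof.
by move=> fS xS; elim: i => //= i IH; apply: fset_stable_mem.
Qed.

(** One notion for both counts: [gamma := id] recovers the coefficients of f_V, and the action of a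
    matrix gives the rational sets that it fixes. *)
Definition stable_subsets (T : choiceType) (sigma gamma : T -> T) (U : set T)
    (n : nat) : set {fset T} :=
  [set S | rational_subsets sigma U n S /\ [fset gamma x | x in S]%fset = S]%classic.

Lemma rational_subsetsE (T : choiceType) (sigma : T -> T) (U : set T) n :
  rational_subsets sigma U n = stable_subsets sigma id U n.
Proof.
apply/seteqP; split => S /=; last by case.
by move=> SU; split => //; rewrite imfset_id.
Qed.

Lemma imfset_in_inj (T T' : choiceType) (e : T -> T') (U : set T) (S1 S2 : {fset T}) :
  {in U &, injective e} -> (forall x, x \in S1 -> U x) -> (forall x, x \in S2 -> U x) ->
  [fset e x | x in S1]%fset = [fset e x | x in S2]%fset -> S1 = S2.
Proof.
move=> eI; wlog suff sub: S1 S2 / [fset e x | x in S1]%fset = [fset e x | x in S2]%fset ->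
    (forall x, x \in S1 -> U x) -> (forall x, x \in S2 -> U x) -> {subset S1 <= S2}.
  move=> S1U S2U E; apply/fsetP => x.
  by apply/idP/idP; apply: sub.
move=> E S1U S2U x xS1.
have: e x \in [fset e x | x in S2]%fset by rewrite -E in_imfset.
by case/imfsetP => y /= yS2 /eI -> //; rewrite inE; [exact: S1U|exact: S2U].
Qed.

Lemma imfset_intertwine (T T' : choiceType) (e : T -> T') (f : T -> T) (f' : T' -> T')
    (S : {fset T}) :
  (forall x, x \in S -> e (f x) = f' (e x)) ->
  [fset f' y | y in [fset e x | x in S]]%fset = [fset e x | x in [fset f x | x in S]]%fset.
Proof.
move=> ef; apply/fsetP => y; apply/imfsetP/imfsetP => -[].
  move=> _ /= /imfsetP[x /= xS ->] ->.
  by exists (f x); rewrite ?in_imfset // ef.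
move=> _ /= /imfsetP[x /= xS ->] ->.
by exists (e x); rewrite ?in_imfset // ef.
Qed.

(** Equivariance is asked on [U] only, so that [e] can be a chart whose formulas fail outside [U],
    as z |-> z^-q does at 0. *)
Lemma card_stable_transport (T T' : choiceType) (e : T -> T')
    (sigma gamma : T -> T) (sigma' gamma' : T' -> T') (U : set T) (V : set T') n :
  {in U &, injective e} -> (e @` U)%classic = V ->
  (forall x, U x -> U (sigma x) /\ e (sigma x) = sigma' (e x)) ->
  (forall x, U x -> U (gamma x) /\ e (gamma x) = gamma' (e x)) ->
  Defs.card (stable_subsets sigma gamma U n) = Defs.card (stable_subsets sigma' gamma' V n).
Proof.
move=> eI eU es eg.
have eSI (S : {fset T}) : (forall x, x \in S -> U x) -> {in S &, injective e}.
  by move=> SU x y /SU xU /SU yU; apply: eI; rewrite inE.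
apply: (@card_bij _ _ (fun S : {fset T} => [fset e x | x in S]%fset)).
  move=> S1 S2; rewrite !inE => -[[_ S1U _] _] [[_ S2U _] _].
  exact: (imfset_in_inj eI).
apply/seteqP; split.
  move=> _ [S [[Sn SU Ss] Sg] <-]; split; last first.
    by rewrite (imfset_intertwine (f := gamma)) ?Sg // => x /SU /eg[].
  split; first by rewrite card_in_imfset //; exact: eSI.
    by move=> _ /imfsetP[x /= /SU xU ->]; rewrite -eU; exists x.
  by rewrite (imfset_intertwine (f := sigma)) ?Ss // => x /SU /es[].
move=> S' [[S'n S'V S's] S'g].
(* Preimages of the points of [S'] are chosen inside [U], the only place where [e] is known to be
   injective. *)
have /choice[h hP] (y : S') : exists x, U x /\ e x = val y.
  by have /S'V := valP y; rewrite -eU => -[x]; exists x.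
pose S := [fset h y | y : S']%fset.
have SU x : x \in S -> U x by case/imfsetP => y /= _ ->; case: (hP y).
have eS : [fset e x | x in S]%fset = S'.
  apply/fsetP => y; apply/imfsetP/idP => [[_ /= /imfsetP[z _ ->] ->]|yS'].
    by rewrite (hP z).2 (valP z).
  by exists (h [` yS']%fset); [rewrite in_imfset|rewrite (hP _).2].
have stab (f : T -> T) (f' : T' -> T') : (forall x, U x -> U (f x) /\ e (f x) = f' (e x)) ->
    [fset f' y | y in S']%fset = S' -> [fset f x | x in S]%fset = S.
  move=> ef S'f; apply: (imfset_in_inj eI _ SU) => [_ /imfsetP[x /= /SU /ef[? _] ->] //|].
  by rewrite -(imfset_intertwine (f' := f')) ?eS // => x /SU /ef[].
exists S => //; split; last exact: (stab _ _ eg).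
split => //; last exact: (stab _ _ es).
by rewrite -S'n -eS; apply/esym/card_in_imfset; exact: eSI.
Qed.

Lemma card_setU_disjoint (T : choiceType) (A B : set T) :
  finite_set A -> finite_set B -> (A `&` B = set0)%classic ->
  Defs.card (A `|` B)%classic = (Defs.card A + Defs.card B)%N.
Proof.
move=> Af Bf AB; rewrite /Defs.card fset_setU // -cardfsUI -fset_setI // AB fset_set0.
by rewrite cardfs0 addn0.
Qed.

Section Quotient.
Variables (T T' : choiceType) (sigma gamma : T -> T) (sigma' : T' -> T').
Variables (pi : T -> T') (U : set T) (V : set T') (d : nat).
Hypotheses (d_gt0 : (0 < d)%N)
  (sigmaU : forall x, U x -> U (sigma x)) (sigma_inj : {in U &, injective sigma})
  (gammaU : forall x, U x -> U (gamma x)) (gamma_inj : {in U &, injective gamma})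
  (piV : forall x, U x -> V (pi x))
  (pi_sigma : forall x, U x -> pi (sigma x) = sigma' (pi x))
  (pi_gamma : forall x, U x -> pi (gamma x) = pi x)
  (pi_fibre : forall x y, U x -> U y -> pi x = pi y -> exists i, y = iter i gamma x)
  (pi_card : forall y, V y -> exists B : {fset T},
     #|` B| = d /\ forall x, x \in B <-> U x /\ pi x = y).

(** Each fibre of [pi] lies in one [gamma]-orbit, so a [gamma]-stable set that meets a fibre
    contains it. *)
Let saturated (S : {fset T}) :
  (forall x, x \in S -> U x) -> [fset gamma x | x in S]%fset = S ->
  forall x, U x -> pi x \in [fset pi x | x in S]%fset -> x \in S.
Proof.
move=> SU Sg x xU /imfsetP[y /= yS /esym exy].
by have [i ->] := pi_fibre (SU _ yS) xU exy; exact: fset_stable_iter.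
Qed.

Let card_saturated (S : {fset T}) :
  (forall x, x \in S -> U x) ->
  (forall x, U x -> pi x \in [fset pi x | x in S]%fset -> x \in S) ->
  #|` S| = (d * #|` [fset pi x | x in S]%fset|)%N.
Proof.
move=> SU Sat; rewrite card_fset_sum1 (partition_big_imfset _ pi) /=.
rewrite (eq_big_seq (fun=> d)) /=; first by rewrite big_const_seq count_predT iter_addn_0.
move=> y yS; have Vy : V y by case/imfsetP: yS => x /= /SU xU ->; exact: piV.
have [B [<- BP]] := pi_card Vy.
have -> : B = [fset x in S | pi x == y]%fset.
  apply/fsetP => x; rewrite !inE /=; apply/idP/andP => [/BP[xU xy]|[xS /eqP xy]].
    by split; [apply: Sat; rewrite ?xy|rewrite xy].
  by apply/BP; split => //; exact: SU.
by rewrite card_fset_sum1 big_fset.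
Qed.

(** A stable set is a union of fibres of [pi] with [d] points each, so it is determined by its
    image, which has n/d points; conversely the inverse image of a [sigma']-stable set is stable. If
    [d] does not divide [n], both sides vanish. *)
Lemma card_stable_quotient n :
  (Defs.card (stable_subsets sigma gamma U n))%:R = fps_dil d (fV sigma' V) n.
Proof.
have inUI (f : T -> T) (S : {fset T}) : {in U &, injective f} ->
    (forall x, x \in S -> U x) -> {in S &, injective f}.
  by move=> fI SU x y /SU xU /SU yU; apply: fI; rewrite inE.
rewrite /fps_dil; case: ifP => [/dvdnP[m ->]|/negP ndn]; last first.
  suff -> : stable_subsets sigma gamma U n = set0 by rewrite /Defs.card fset_set0 cardfs0.
  apply/seteqP; split => // S [[Sn SU _] Sg]; case: ndn.
  by rewrite -Sn (card_saturated SU (saturated SU Sg)) dvdn_mulr.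
rewrite mulnK // /fV; congr (_%:R).
apply: (@card_bij _ _ (fun S : {fset T} => [fset pi x | x in S]%fset)).
  move=> S1 S2; rewrite !inE => -[[_ S1U _] S1g] [[_ S2U _] S2g] E.
  apply/fsetP => x; apply/idP/idP => xS.
    by apply: (saturated S2U S2g); [exact: S1U|rewrite -E in_imfset].
  by apply: (saturated S1U S1g); [exact: S2U|rewrite E in_imfset].
apply/seteqP; split.
  move=> _ [S [[Sn SU Ss] Sg] <-]; split.
  - apply/eqP; rewrite -(eqn_pmul2l d_gt0) -(card_saturated SU (saturated SU Sg)).
    by rewrite Sn mulnC.
  - by move=> _ /imfsetP[x /= /SU xU ->]; exact: piV.
  - by rewrite (imfset_intertwine (f := sigma)) ?Ss // => x /SU /pi_sigma.
move=> S' [S'm S'V S's].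
have /choice[B BP] (y : S') : exists B : {fset T}, #|` B| = d /\
    forall x, x \in B <-> U x /\ pi x = val y.
  exact/pi_card/S'V/valP.
(* The inverse image of [S'] as a finite set: the union of its fibres. *)
pose S := (\bigcup_(y <- enum {: S'}) B y)%fset.
have inS x : x \in S <-> U x /\ pi x \in S'.
  split=> [/bigfcupP[y _ /(BP y).2[xU ->]]|[xU xS']]; first by split; rewrite ?(valP y).
  by apply/bigfcupP; exists [` xS']%fset; rewrite ?mem_enum //; apply/(BP _).2.
have SU x : x \in S -> U x by case/inS.
have piS : [fset pi x | x in S]%fset = S'.
  apply/fsetP => y; apply/imfsetP/idP => [[x /= /inS[_ ?] ->//]|yS'].
  have : (0 < #|` B [` yS']%fset|)%N by rewrite (BP _).1.
  rewrite cardfs_gt0 => /fset0Pn[x xB].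
  have /(BP _).2 /= [xU xy] := xB.
  by exists x; rewrite ?xy //=; apply/inS; rewrite xy.
exists S => //; split; last first.
  apply: fset_stableP; first exact: inUI gamma_inj SU.
  by move=> x /inS[xU xS]; apply/inS; rewrite pi_gamma //; split => //; exact: gammaU.
split => //; last first.
  apply: fset_stableP; first exact: inUI sigma_inj SU.
  move=> x /inS[xU xS]; apply/inS; rewrite pi_sigma //; split; first exact: sigmaU.
  exact: fset_stable_mem.
rewrite (card_saturated SU) ?piS ?S'm 1?mulnC // => x xU xS; exact/inS.
Qed.

End Quotient.

(* [F] is a single [sigma]-orbit, so a [sigma]-stable set contains it or avoids
   it. *)
Section Atom.
Variables (T : choiceType) (sigma gamma : T -> T) (U : set T) (F : {fset T}).
Hypotheses (sigma_inj : injective sigma) (gamma_inj : injective gamma)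
  (UF : forall x, U x -> x \notin F)
  (sigmaF : [fset sigma x | x in F]%fset = F) (gammaF : [fset gamma x | x in F]%fset = F)
  (F_orbit : forall x y, x \in F -> y \in F -> exists i, y = iter i sigma x)
  (F_gt0 : (0 < #|` F|)%N).

(** In generating functions, adjoining [F] multiplies by 1 + x^|F|. Finiteness enters because [card]
    is additive only on finite sets. *)
Lemma card_stable_atom n :
  finite_set (stable_subsets sigma gamma (U `|` [set` F])%classic n) ->
  Defs.card (stable_subsets sigma gamma (U `|` [set` F])%classic n) =
  (Defs.card (stable_subsets sigma gamma U n) +
   if (#|` F| <= n)%N then Defs.card (stable_subsets sigma gamma U (n - #|` F|)) else 0)%N.
Proof.
move=> fin; set V := (U `|` _)%classic in fin *.
have disj S : (forall x, x \in S -> U x) -> [disjoint S & F]%fset.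
  by move=> SU; apply/fdisjointP => x /SU /UF.
have stabU f S : [fset f x | x in F]%fset = F ->
    [fset f x | x in S]%fset = S -> [fset f x | x in S `|` F]%fset = (S `|` F)%fset.
  by move=> Ff Sf; rewrite imfsetU Ff Sf.
have stabD f S : injective f -> [fset f x | x in F]%fset = F ->
    [fset f x | x in S]%fset = S -> [fset f x | x in S `\` F]%fset = (S `\` F)%fset.
  move=> fI Ff Sf; apply: fset_stableP => [x y _ _|x]; first exact: fI.
  rewrite !inE => /andP[xF xS]; apply/andP; split; last exact: fset_stable_mem.
  by apply: contra xF; rewrite -{1}Ff => /imfsetP[y /= yF /fI ->].
pose A := stable_subsets sigma gamma U n.
pose B := ((fun S => S `|` F)%fset @` [set S | (#|` F| <= n)%N /\
  stable_subsets sigma gamma U (n - #|` F|) S])%classic.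
have VAB : stable_subsets sigma gamma V n = (A `|` B)%classic.
  apply/seteqP; split.
    move=> S [[Sn SV Ss] Sg].
    have [/eqP SF|/fset0Pn[x0]] := boolP (S `&` F == fset0)%fset.
      left; split => //; split => // x xS; case: (SV x xS) => //= xF.
      by move/fsetP/(_ x): SF; rewrite !inE xS xF.
    rewrite !inE => /andP[x0S x0F]; right.
    have FS : (F `<=` S)%fset.
      apply/fsubsetP => y yF; have [i ->] := F_orbit x0F yF.
      exact: fset_stable_iter.
    exists (S `\` F)%fset => /=; last by rewrite fsetUC fsetUDl fsetDv fsetD0; apply/fsetUidPr.
    split; first by rewrite -Sn; exact: fsubset_leq_card.
    split; last exact: stabD.
    split; last exact: stabD.
      by rewrite cardfsDS // Sn.
    by move=> x; rewrite !inE => /andP[xF /SV[//|/= xF']]; rewrite xF' in xF.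
  move=> S [[[Sn SU Ss] Sg]|[S' [Fn [[Sn SU Ss] Sg]] <-]].
    by split => //; split => // x /SU; left.
  split; last exact: stabU.
  split; last exact: stabU.
    by rewrite cardfsU (eqP (disj _ SU)) cardfs0 subn0 Sn subnK.
  by move=> x; rewrite inE => /orP[/SU|]; [left|right].
have Af : finite_set A by apply: (sub_finite_set _ fin); rewrite VAB => S ?; left.
have Bf : finite_set B by apply: (sub_finite_set _ fin); rewrite VAB => S ?; right.
have AB : (A `&` B = set0)%classic.
  apply/seteqP; split => // S [[[_ SU _] _] [S' _ SE]].
  have /fset0Pn[x xF] : F != fset0 by rewrite -cardfs_gt0.
  by have /SU/UF : x \in S by [rewrite -SE inE xF orbT]; rewrite xF.
rewrite VAB card_setU_disjoint //.
congr addn; rewrite /B; case: ifP => Fn; last first.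
  by rewrite (_ : (_ @` _)%classic = set0) /Defs.card ?fset_set0 ?cardfs0 //;
     apply/seteqP; split => // S [S' []].
apply/esym/(@card_bij _ _ (fun S => S `|` F)%fset); last first.
  by congr (_ @` _)%classic; apply/seteqP; split => S //= [].
move=> S1 S2; rewrite !inE => -[[_ S1U _] _] [[_ S2U _] _] E.
have D S : [disjoint S & F]%fset -> ((S `|` F) `\` F)%fset = S.
  by move=> SF; rewrite fsetDUl fsetDv fsetU0; apply/fsetDidPl.
by rewrite -(D S1 (disj _ S1U)) E D // disj.
Qed.

End Atom.

(** * Frobenius *)

(** A point of a stable n-set has period at most n, hence is fixed by the n!-th iterate; so all
    these sets are subsets of one finite set. *)
Lemma finite_rational_subsets (T : choiceType) (sigma : T -> T) (U : set T) n :
  injective sigma ->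
  (forall m, (0 < m)%N -> finite_set [set x | iter m sigma x = x]%classic) ->
  finite_set (rational_subsets sigma U n).
Proof.
move=> sI /(_ n`! (fact_gt0 n)) fin; pose X := fset_set [set x | iter n`! sigma x = x]%classic.
apply: (@sub_finite_set _ _ [set` fpowerset X]) => // S [Sn _ Ss] /=.
rewrite fpowersetE; apply/fsubsetP => x xS; rewrite /X in_fset_set // inE /=.
(* Pigeonhole: [x] and its first n iterates lie in [S], which has only n elements. *)
have: ~~ uniq (traject sigma x n.+1).
  apply/negP => u; suff: (n.+1 <= n)%N by rewrite ltnn.
  rewrite -{2}Sn -(size_traject sigma x n.+1); apply: uniq_leq_size => //.
  by move=> _ /trajectP[i _ ->]; apply: fset_stable_iter.
rewrite looping_uniq negbK => /loopingP/(_ n)/trajectP[i lt_in].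
rewrite -{1}(subnK (ltnW lt_in)) addnC iterD; set m := (n - i)%N => E.
have itI j : injective (iter j sigma) by elim: j => //= j IH a b /sI/IH.
have xm : iter m sigma x = x by exact: (itI i).
have m_gt0 : (0 < m)%N by rewrite subn_gt0.
have /dvdnP[c cE] : (m %| n`!)%N by apply: dvdn_fact; rewrite m_gt0 leq_subr.
rewrite cE; elim: {cE} c => // c IH; by rewrite mulSn iterD IH.
Qed.

Section Frobenius.
Variables (k : finFieldType) (K : fieldType) (iota : {rmorphism k -> K}).
Notation q := #|k|.
Notation frob := (@frob k K).

Lemma pchar_card_pnat : [pchar K].-nat q.
Proof.
have [p _ pk] := finPcharP k.
rewrite (eq_pnat _ (fmorph_pchar iota)).
have /abelem_pgroup := fin_ring_pchar_abelem pk; rewrite /pgroup cardsT.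
by apply: sub_in_pnat => l _ /eqP ->.
Qed.

Lemma frobM : {morph frob : a b / a * b}.
Proof. by move=> a b; rewrite /frob exprMn. Qed.

Lemma frobD : {morph frob : a b / a + b}.
Proof. by move=> a b; rewrite /frob exprDn_pchar // pchar_card_pnat. Qed.

Lemma frob0 : frob 0 = 0.
Proof. by rewrite /frob expr0n eqn0Ngt (ltnW (finNzRing_gt1 k)). Qed.

Lemma frob1 : frob 1 = 1.
Proof. exact: expr1n. Qed.

Lemma frobN a : frob (- a) = - frob a.
Proof. by apply/eqP; rewrite -addr_eq0 -frobD addNr frob0. Qed.

Lemma frob_eq0 a : (frob a == 0) = (a == 0).
Proof. by rewrite expf_eq0 (ltnW (finNzRing_gt1 k)). Qed.

Lemma frob_inj : injective frob.
Proof.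
by move=> a b E; apply/eqP; rewrite -subr_eq0 -frob_eq0 frobD frobN E subrr.
Qed.

Lemma frob_iota a : frob (iota a) = iota a.
Proof. by rewrite /frob -rmorphXn /= expf_card. Qed.

(** X^q - X is the product of the X - b for b in [k], and stays so over [K]. *)
Lemma frob_fixed a : frob a = a -> exists b, a = iota b.
Proof.
move=> Ea; have: root (map_poly iota ('X^q - 'X)) a.
  by rewrite rmorphB /= map_polyXn map_polyX rootE !hornerE -/(frob a) Ea subrr.
rewrite finField_genPoly rmorph_prod /= rootE horner_prod prodf_seq_eq0.
case/hasP => b _; rewrite /= map_polyXsubC !hornerE subr_eq0 => /eqP ->.
by exists b.
Qed.

Lemma iter_frob m a : iter m frob a = a ^+ (q ^ m).
Proof. by elim: m => [|m IH]; rewrite ?expr1 //= IH /frob -exprM expnSr. Qed.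

Lemma map_frob_mulmx m n l (A : 'M[K]_(m, n)) (B : 'M[K]_(n, l)) :
  map_mx frob (A *m B) = map_mx frob A *m map_mx frob B.
Proof.
apply/matrixP => i j; rewrite !mxE (big_morph frob frobD frob0).
by apply: eq_bigr => s _; rewrite !mxE frobM.
Qed.

Lemma map_frob_iota m n (A : 'M[k]_(m, n)) :
  map_mx frob (map_mx iota A) = map_mx iota A.
Proof. by apply/matrixP => i j; rewrite !mxE frob_iota. Qed.

End Frobenius.

Lemma poly_roots_fset (K : closedFieldType) (P : {poly K}) :
  P != 0 -> {r : {fset K} | forall x, (x \in r) = root P x}.
Proof.
move=> P0; have [r Pr] := closed_field_poly_normal P.
exists [fset x in r]%fset => x; rewrite inE /= Pr rootZ ?lead_coef_eq0 //.
by rewrite root_prod_XsubC.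
Qed.

Lemma finite_iter_frob (k : finFieldType) (K : closedFieldType) m :
  (0 < m)%N -> finite_set [set a | iter m (@frob k K) a = a]%classic.
Proof.
move=> m_gt0; have := leq_ltn_trans m_gt0 (ltn_expl m (finNzRing_gt1 k)).
rewrite (_ : [set a | _]%classic = [set a | a ^+ (#|k| ^ m) = a]%classic); last first.
  by apply/seteqP; split => a /=; rewrite iter_frob.
move: (#|k| ^ m)%N => N N_gt1; have P0 : 'X^N - 'X != 0 :> {poly K}.
  by rewrite -size_poly_gt0 size_polyDl ?size_polyXn // size_polyN size_polyX.
have [r rP] := poly_roots_fset P0.
apply: (@sub_finite_set _ _ [set` r]) => // a /= aN.
by rewrite rP rootE !hornerE aN subrr.
Qed.

(** * Points of the projective line *)

Section Points.
Variable K : fieldType.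
Implicit Types (u v w : 'cV[K]_2) (x y z c : K).

Lemma const1_neq0 : (const_mx 1 : 'cV[K]_2) != 0.
Proof. by apply/negP => /eqP/matrixP/(_ 0 0); rewrite !mxE => /eqP; rewrite oner_eq0. Qed.

(* Junk value at [v = 0]: the point [1 : 1]. *)
Definition pt v : P1 K := insubd (P1_of const1_neq0) <[v]>%VS.

Lemma pt_of v (v0 : v != 0) : pt v = P1_of v0.
Proof. by apply/val_inj; rewrite insubdK //= unfold_in /= dim_vline v0. Qed.

Lemma pt_surj (a : P1 K) : exists2 v, v != 0 & a = pt v.
Proof.
exists (vpick (val a)); first exact: P1_vpick.
rewrite (pt_of (P1_vpick a)); apply/val_inj/esym/eqP; rewrite eqEdim /=.
by rewrite dim_vline P1_vpick (eqP (valP a)) andbT -memvE memv_pick.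
Qed.

Lemma pt_scale c v : c != 0 -> pt (c *: v) = pt v.
Proof.
move=> c0; have [->|v0] := eqVneq v 0; first by rewrite scaler0.
have cv0 : c *: v != 0 by rewrite scaler_eq0 negb_or c0.
by rewrite (pt_of v0) (pt_of cv0); apply: P1_of_eqP; exists c.
Qed.

Lemma pt_eq v w : v != 0 -> w != 0 -> pt v = pt w -> exists c, v = c *: w.
Proof.
move=> v0 w0; rewrite (pt_of v0) (pt_of w0) => /(congr1 val) /= E.
by apply/vlineP; rewrite -E memv_line.
Qed.

Lemma pt_frobP1 (k : finFieldType) v :
  v != 0 -> frobP1 k (pt v) = pt (map_mx (@frob k K) v).
Proof. by move=> v0; rewrite (pt_of v0) frobP1_of (pt_of (frob_neq0 k v0)). Qed.

Lemma pt_GL2_act (k : finFieldType) (iota : {rmorphism k -> K}) (g : {'GL_2[k]}) v :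
  v != 0 -> GL2_act iota g (pt v) = pt (map_mx iota (GLval g) *m v).
Proof.
by move=> v0; rewrite (pt_of v0) GL2_act_of (pt_of (GL2_act_neq0 iota g v0)).
Qed.

(** The determinant with columns [v] and [w] is nonzero: the two vectors form a basis. *)
Definition frame v w := v 0 0 * w 1 0 - v 1 0 * w 0 0 != 0.

Lemma colP2 u v : u 0 0 = v 0 0 -> u 1 0 = v 1 0 -> u = v.
Proof.
move=> E0 E1; apply/matrixP => i j; rewrite (ord1 j).
case: i => -[|[|//]] i_lt; [rewrite (_ : Ordinal _ = 0)|rewrite (_ : Ordinal _ = 1)] => //;
  exact/val_inj.
Qed.

Lemma frame_free v w x y : frame v w -> x *: v + y *: w = 0 -> x = 0 /\ y = 0.
Proof.
rewrite /frame; set D := _ - _ => D0 /matrixP E.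
have := E 0 0; have := E 1 0; rewrite !mxE => E1 E0.
have xD : x * D = 0.
  transitivity ((x * v 0 0 + y * w 0 0) * w 1 0 - (x * v 1 0 + y * w 1 0) * w 0 0).
    by rewrite /D; ring.
  by rewrite E0 E1 !mul0r subr0.
have yD : y * D = 0.
  transitivity ((x * v 1 0 + y * w 1 0) * v 0 0 - (x * v 0 0 + y * w 0 0) * v 1 0).
    by rewrite /D; ring.
  by rewrite E0 E1 !mul0r subr0.
by split; apply/eqP; [have /eqP := xD|have /eqP := yD]; rewrite mulf_eq0 (negPf D0) orbF.
Qed.

Lemma frame_span v w u : frame v w -> exists x y, u = x *: v + y *: w.
Proof.
rewrite /frame; set D := _ - _ => D0.
(* Cramer's rule. *)
exists ((u 0 0 * w 1 0 - u 1 0 * w 0 0) / D), ((v 0 0 * u 1 0 - v 1 0 * u 0 0) / D).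
by apply: colP2; rewrite !mxE /D; field.
Qed.

Lemma frameP v w : v != 0 -> (forall c, w != c *: v) -> frame v w.
Proof.
move=> v0 wv; apply/negP; rewrite subr_eq0 => /eqP D.
have [v00|v00] := eqVneq (v 0 0) 0.
  have v10 : v 1 0 != 0.
    by apply: contra v0 => /eqP v10; apply/eqP/colP2; rewrite mxE.
  have /eqP := D; rewrite v00 mul0r eq_sym mulf_eq0 (negPf v10) => /= /eqP w00.
  by have /eqP := wv (w 1 0 / v 1 0); apply; apply: colP2; rewrite !mxE ?v00 ?w00 ?mulr0 ?divfK.
have /eqP := wv (w 0 0 / v 0 0); apply; apply: colP2; rewrite !mxE ?divfK //.
by apply: (mulfI v00); rewrite D; field.
Qed.

Section Coordinates.
Variables (v w : 'cV[K]_2).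
Hypothesis vw : frame v w.

(** The point [x : y] in homogeneous coordinates for the basis [v], [w]: [coord z 1] runs through an
    affine line and [coord 1 0] is its point at infinity. *)
Definition coord x y := pt (x *: v + y *: w).

Lemma coord_neq0 x y : (x != 0) || (y != 0) -> x *: v + y *: w != 0.
Proof.
by move=> xy; apply/negP => /eqP /(frame_free vw) [x0 y0]; rewrite x0 y0 eqxx in xy.
Qed.

Lemma coord_eq x y x' y' : (x != 0) || (y != 0) -> (x' != 0) || (y' != 0) ->
  coord x y = coord x' y' -> x * y' = x' * y.
Proof.
move=> xy xy' /(pt_eq (coord_neq0 xy) (coord_neq0 xy'))[c E].
have [] := @frame_free v w (x - c * x') (y - c * y') vw.
  apply/eqP; rewrite !scalerBl addrACA -opprD subr_eq0 E.
  by rewrite scalerDr !scalerA.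
by move=> /subr0_eq -> /subr0_eq ->; ring.
Qed.

Lemma coord_scale c x y : c != 0 -> coord (c * x) (c * y) = coord x y.
Proof. by move=> c0; rewrite /coord -!scalerA -scalerDr pt_scale. Qed.

Lemma coord_surj (a : P1 K) : a = coord 1 0 \/ exists z, a = coord z 1.
Proof.
have [u u0 ->] := pt_surj a; have [x [y uE]] := frame_span u vw.
have [y0|y0] := eqVneq y 0; [left|right; exists (x / y)].
  have x0 : x != 0 by apply: contra u0 => /eqP x0; rewrite uE x0 y0 !scale0r addr0.
  by rewrite -(coord_scale _ _ x0) mulr0 mulr1 /coord -y0 -uE.
by rewrite -(coord_scale _ _ y0) mulr1 mulrC divfK // /coord -uE.
Qed.

Lemma coord_affine_inj : injective (fun z => coord z 1).
Proof. by move=> x y /coord_eq; rewrite oner_eq0 !orbT !mulr1 => ->. Qed.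

Lemma coord_affine_infty z : coord z 1 <> coord 1 0.
Proof.
by move/coord_eq; rewrite oner_eq0 orbT mulr0 mul1r => /(_ isT isT)/esym/eqP; rewrite oner_eq0.
Qed.

End Coordinates.

End Points.

(** * Kummer and Artin-Schreier quotients *)

Lemma closed_field_preimage (K : closedFieldType) (P : {poly K}) y :
  (1 < size P)%N -> exists r, P.[r] = y.
Proof.
move=> sP; have : size (P - y%:P) != 1%N.
  rewrite size_polyDl ?size_polyN ?neq_ltn ?sP ?orbT //.
  by apply: leq_ltn_trans sP; rewrite size_polyC; case: (y != 0).
by case/closed_rootP => r; rewrite rootE !hornerE subr_eq0 => /eqP; exists r.
Qed.

(** The fibres of z |-> z^d on K^* are the orbits of multiplication by [zeta], each with exactly d
    points. The map [sigma] is only asked to commute with this power, which holds for z^q and for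
    z^-q. *)
Lemma card_stable_kummer (K : closedFieldType) (sigma : K -> K) (zeta : K) (d n : nat) :
  d.-primitive_root zeta ->
  (forall x, x != 0 -> sigma x != 0) ->
  {in [set x : K | x != 0]%classic &, injective sigma} ->
  (forall x, sigma (x ^+ d) = sigma x ^+ d) ->
  (Defs.card (stable_subsets sigma ( *%R zeta) [set x | x != 0]%classic n))%:R =
  fps_dil d (fV sigma [set x | x != 0]%classic) n.
Proof.
move=> prim s0 sI sX; have d_gt0 := prim_order_gt0 prim.
have zeta0 : zeta != 0 by rewrite (prim_root_eq0 prim) -lt0n.
apply: (@card_stable_quotient _ _ _ _ _ (fun x => x ^+ d)) => //=.
- by move=> x x0; rewrite mulf_neq0.
- by move=> x y _ _; exact: mulfI.
- by move=> x x0; rewrite expf_neq0.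
- by move=> x _; rewrite exprMn (prim_expr_order prim) mul1r.
- move=> x y x0 y0 E; have: (y / x) ^+ d = 1.
    by rewrite exprMn -E -exprMn divff ?expr1n.
  case/(prim_rootP prim) => i /(canRL (divfK x0)) ->; exists i.
  by elim: (i : nat) => [|j IH] /=; rewrite ?mul1r // exprS -mulrA IH.
move=> y y0; have [r rE] : exists r, ('X^d).[r] = y.
  by apply: closed_field_preimage; rewrite size_polyXn.
have r0 : r != 0.
  by apply: contra y0 => /eqP r0; rewrite -rE hornerXn r0 expr0n eqn0Ngt d_gt0.
pose f (i : 'I_d) := zeta ^+ i * r; exists [fset f i | i : 'I_d]%fset; split.
  rewrite card_imfset /= ?size_enum_ord // => i j /(mulIf r0) /eqP.
  by rewrite (eq_prim_root_expr prim) !modn_small // => /eqP E; exact: val_inj.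
move=> x; split => [/imfsetP[i _ ->]|[x0 xE]].
  split; first by rewrite mulf_neq0 // expf_neq0.
  by rewrite exprMn exprAC (prim_expr_order prim) expr1n mul1r -hornerXn.
have: (x / r) ^+ d = 1 by rewrite exprMn xE -rE hornerXn -exprMn divff ?expr1n.
by case/(prim_rootP prim) => i /(canRL (divfK r0)) ->; apply/imfsetP; exists i.
Qed.

Lemma natr_ord_inj (K : fieldType) p : p \in [pchar K] ->
  injective (fun i : 'I_p => (i : nat)%:R : K).
Proof.
move=> pK i j E; apply/val_inj => /=.
wlog le_ij : i j E / (i <= j)%N.
  by move=> W; case/orP: (leq_total i j) => /W; [apply|move=> <-].
have := dvdn_pcharf pK (j - i); rewrite natrB // E subrr eqxx => /dvdnP[[|m] jE].
  by apply/eqP; rewrite eqn_leq le_ij -subn_eq0 jE mul0n.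
by have := leq_ltn_trans (leq_subr i j) (ltn_ord j); rewrite jE mulSn ltnNge leq_addr.
Qed.

(** The p residues are already roots of X^p - X, which has no room for a further one. *)
Lemma prime_field_fixed (K : fieldType) p (c : K) : p \in [pchar K] -> c ^+ p = c ->
  exists i : 'I_p, c = (i : nat)%:R.
Proof.
move=> pK cp; have p_gt1 := prime_gt1 (pcharf_prime pK).
have sP : size ('X^p - 'X : {poly K}) = p.+1.
  by rewrite size_polyDl ?size_polyXn // size_polyN size_polyX.
have P0 : 'X^p - 'X != 0 :> {poly K} by rewrite -size_poly_gt0 sP.
pose s := [seq (i : nat)%:R : K | i : 'I_p <- enum 'I_p].
have us : uniq s.
  by rewrite map_inj_uniq ?enum_uniq //; exact: natr_ord_inj.
have [/mapP[i _ ->]|cs] := boolP (c \in s); first by exists i.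
have rs : all (root ('X^p - 'X)) (c :: s).
  apply/allP => x; rewrite inE => /predU1P[->|/mapP[i _ ->]].
    by rewrite rootE !hornerE cp subrr.
  by rewrite rootE !hornerE -[_ ^+ p](pFrobenius_autE pK) pFrobenius_aut_nat subrr.
have := max_poly_roots P0 rs.
by rewrite /= cs us sP size_map size_enum_ord ltnn => /(_ isT).
Qed.

(** The map z |-> z^p - z is additive with kernel the prime field, so its fibres are the orbits of z
    |-> z + 1, and it commutes with Frobenius. *)
Lemma card_stable_artin_schreier (k : finFieldType) (K : closedFieldType)
    (iota : {rmorphism k -> K}) p n :
  p \in [pchar K] ->
  (Defs.card (stable_subsets (@frob k K) (fun x => x + 1) [set: K]%classic n))%:R =
  fps_dil p (fV (@frob k K) [set: K]%classic) n.
Proof.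
move=> pK; have p_gt1 := prime_gt1 (pcharf_prime pK).
have expD (x y : K) : (x + y) ^+ p = x ^+ p + y ^+ p.
  by rewrite -!(pFrobenius_autE pK) pFrobenius_autD_comm //; exact: mulrC.
have expN (x : K) : (- x) ^+ p = - x ^+ p.
  by apply/eqP; rewrite -addr_eq0 -expD addNr expr0n eqn0Ngt (ltnW p_gt1).
have expn (i : nat) : (i%:R : K) ^+ p = i%:R.
  by rewrite -!(pFrobenius_autE pK) pFrobenius_aut_nat.
apply: (@card_stable_quotient _ _ _ _ _ (fun x => x ^+ p - x)) => //=.
- exact: ltnW.
- by move=> x y _ _; exact: (frob_inj iota).
- by move=> x y _ _; exact: addIr.
- by move=> x _; rewrite (frobD iota) (frobN iota) /frob exprAC.
- by move=> x _; rewrite expD expr1n; ring.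
- move=> x y _ _ E; have [i iE] : exists i : 'I_p, y - x = (i : nat)%:R.
    apply: prime_field_fixed => //; rewrite expD expN.
    by rewrite -[y ^+ p](subrK y) -E; ring.
  exists i; rewrite -[y](subrK x) iE.
  by elim: (i : nat) => [|j IH] /=; rewrite ?add0r // -IH -addn1 natrD; ring.
move=> y _; have [r rE] : exists r, ('X^p - 'X).[r] = y.
  apply: closed_field_preimage.
  by rewrite size_polyDl size_polyXn ?size_polyN ?size_polyX // ltnW.
rewrite !hornerE in rE.
pose f (i : 'I_p) := r + i%:R; exists [fset f i | i : 'I_p]%fset; split.
  by rewrite card_imfset /= ?size_enum_ord // => i j /addrI /natr_ord_inj; apply.
move=> x; split => [/imfsetP[i _ ->]|[_ xE]].
  by split => //; rewrite /f expD expn -rE; ring.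
have [i iE] : exists i : 'I_p, x - r = (i : nat)%:R.
  apply: prime_field_fixed => //; rewrite expD expN.
  by rewrite -[x ^+ p](subrK x) xE -rE; ring.
by apply/imfsetP; exists i; rewrite //= /f -iE addrC subrK.
Qed.

(** * Sets fixed by a matrix *)

Lemma fps_mul_poly1 (f : fps) : fps_mul (fps_poly 1) f =1 f.
Proof.
move=> n; rewrite /fps_mul big_ord_recl /fps_poly coef1 mul1r subn0 big1 ?addr0 // => i _.
by rewrite coef1 /= mul0r.
Qed.

(** This is the recursion obeyed by the counts when a Frobenius orbit of [e] points is adjoined; it
    lets orbits be adjoined one after another. *)
Lemma fps_mul_poly1DXn (P : {poly rat}) e (f : fps) n :
  fps_mul (fps_poly ((1 + 'X^e) * P)) f n =
  fps_mul (fps_poly P) f n + (if (e <= n)%N then fps_mul (fps_poly P) f (n - e) else 0).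
Proof.
rewrite mulrDl mul1r /fps_mul /fps_poly.
under eq_bigr do rewrite coefD coefXnM mulrDl.
rewrite big_split /=; congr (_ + _).
case: leqP => [le_en|lt_ne].
  rewrite -(big_mkord predT (fun i => (if (i < e)%N then 0 else P`_(i - e)) * f (n - i)%N)).
  rewrite (big_cat_nat _ (n := e)) //= ?leqW // big_nat big1 ?add0r; last first.
    by move=> i /= lt_ie; rewrite lt_ie mul0r.
  rewrite -{1}[e]add0n big_addn subSn // big_mkord; apply: eq_bigr => i _.
  by rewrite ltnNge leq_addl /= addnK addnC subnDA.
rewrite big1 // => i _.
by rewrite (leq_trans (ltn_ord i) lt_ne) mul0r.
Qed.

Section Geometry.
Variables (k : finFieldType) (K : closedFieldType) (iota : {rmorphism k -> K}).
Notation frob := (@frob k K).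
Notation frobP1 := (@frobP1 k K).
Notation act := (GL2_act iota).
Notation Kstar := [set x : K | x != 0]%classic.

Lemma GL2_act1 a : act 1%g a = a.
Proof.
have [v v0 ->] := pt_surj a.
by rewrite pt_GL2_act // GL_1E map_scalar_mx rmorph1 mul1mx.
Qed.

Lemma GL2_actM g h a : act (g * h)%g a = act g (act h a).
Proof.
have [v v0 ->] := pt_surj a.
rewrite !pt_GL2_act ?GL2_act_neq0 //.
by rewrite GL_ME map_mxM mulmxA.
Qed.

Lemma GL2_act_inj g : injective (act g).
Proof. by apply: (can_inj (g := act g^-1%g)) => a; rewrite -GL2_actM mulVg GL2_act1. Qed.

Section RationalFrame.
Variables (v w : 'cV[K]_2).
Hypotheses (vw : frame v w) (frob_v : map_mx frob v = v) (frob_w : map_mx frob w = w).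

Lemma map_frob_comb (v' w' : 'cV[K]_2) x y :
  map_mx frob (x *: v' + y *: w') = frob x *: map_mx frob v' + frob y *: map_mx frob w'.
Proof. by apply/matrixP => i j; rewrite !mxE (frobD iota) !frobM. Qed.

Lemma frobP1_coord x y : (x != 0) || (y != 0) ->
  frobP1 (coord v w x y) = coord v w (frob x) (frob y).
Proof.
by move=> xy; rewrite pt_frobP1 ?coord_neq0 // map_frob_comb frob_v frob_w.
Qed.

Lemma frobP1_affine z : frobP1 (coord v w z 1) = coord v w (frob z) 1.
Proof. by rewrite frobP1_coord ?oner_eq0 ?orbT // frob1. Qed.

Lemma frobP1_infty : frobP1 (coord v w 1 0) = coord v w 1 0.
Proof. by rewrite frobP1_coord ?oner_eq0 // frob1 frob0. Qed.

End RationalFrame.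

(** The standard basis supplies rational coordinates for the facts that involve no matrix:
    injectivity of Frobenius, finiteness, the shape of points of degree two. *)
Let std0 : 'cV[K]_2 := \col_i (i == 0)%:R.
Let std1 : 'cV[K]_2 := \col_i (i == 1)%:R.
Let std_frame : frame std0 std1.
Proof. by rewrite /frame !mxE /= mulr1 mulr0 subr0 oner_eq0. Qed.
Let frob_std0 : map_mx frob std0 = std0.
Proof. by apply/matrixP => i j; rewrite !mxE; case: eqP; rewrite ?frob1 ?frob0. Qed.
Let frob_std1 : map_mx frob std1 = std1.
Proof. by apply/matrixP => i j; rewrite !mxE; case: eqP; rewrite ?frob1 ?frob0. Qed.

Lemma frobP1_inj : injective frobP1.
Proof.
have aff := frobP1_affine std_frame frob_std0 frob_std1.
have inf := frobP1_infty std_frame frob_std0 frob_std1.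
move=> a b; case: (coord_surj std_frame a) => [->|[x ->]];
  case: (coord_surj std_frame b) => [->|[y ->]] //; rewrite ?aff ?inf.
- by move/esym/(coord_affine_infty std_frame).
- by move/(coord_affine_infty std_frame).
- by move/(coord_affine_inj std_frame)/(frob_inj iota) => ->.
Qed.

Lemma finite_rational_nsets n : finite_set (rational_nsets k (K := K) n).
Proof.
apply: finite_rational_subsets; first exact: frobP1_inj.
move=> m m_gt0.
apply: (@sub_finite_set _ _ ([set coord std0 std1 1 0] `|`
    [set coord std0 std1 z 1 | z in [set z | iter m frob z = z]])%classic); last first.
  rewrite finite_setU; split; first exact: finite_set1.
  exact/finite_image/finite_iter_frob.
move=> a /=; case: (coord_surj std_frame a) => [->|[z ->]]; first by left.
have -> j : iter j frobP1 (coord std0 std1 z 1) = coord std0 std1 (iter j frob z) 1.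
  by elim: j => //= j ->; rewrite (frobP1_affine std_frame).
by move/(coord_affine_inj std_frame) => zm; right; exists z.
Qed.

Lemma finite_stable_P1 gamma U n : finite_set (stable_subsets frobP1 gamma U n).
Proof.
apply: sub_finite_set (finite_rational_nsets n) => S [[Sn _ Ss] _].
by split.
Qed.

Section Frame.
Variables (v w : 'cV[K]_2).
Hypothesis vw : frame v w.
Notation crd := (coord v w).
Notation aff := (fun z => coord v w z 1).

Lemma affine_cover : [set: P1 K]%classic = (aff @` [set: K] `|` [set` [fset crd 1 0]%fset])%classic.
Proof.
apply/seteqP; split => // a _; case: (coord_surj vw a) => [->|[z ->]].
  by right; exact: fset11.
by left; exists z.
Qed.

(** For rational eigenvectors the points at infinity and 0 are peeled off one at a time; when
    Frobenius exchanges them they have to be removed together, as in [Kstar_cover]. *)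
Lemma affine_Kstar_cover : (aff @` [set: K])%classic =
  (aff @` Kstar `|` [set` [fset crd 0 1]%fset])%classic.
Proof.
apply/seteqP; split => [a [z _ <-]|a [[z _ <-]|]].
- by have [->|z0] := eqVneq z 0; [right; exact: fset11|left; exists z].
- by exists z.
- by move=> /fset1P ->; exists 0.
Qed.

Lemma Kstar_cover : [set: P1 K]%classic =
  (aff @` Kstar `|` [set` [fset crd 1 0; crd 0 1]%fset])%classic.
Proof.
apply/seteqP; split => // a _; case: (coord_surj vw a) => [->|[z ->]].
  by right; apply/fset2P; left.
by have [->|z0] := eqVneq z 0; [right; apply/fset2P; right|left; exists z].
Qed.

Lemma affine_notin_infty a : (aff @` [set: K])%classic a -> a \notin [fset crd 1 0]%fset.
Proof. by case=> z _ <-; apply/negP => /fset1P/(coord_affine_infty vw). Qed.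

Lemma Kstar_notin_zero a : (aff @` Kstar)%classic a -> a \notin [fset crd 0 1]%fset.
Proof.
case=> z z0 <-; apply/negP => /fset1P/(coord_affine_inj vw) z0'.
by rewrite /= z0' eqxx in z0.
Qed.

Lemma Kstar_notin_axes a : (aff @` Kstar)%classic a -> a \notin [fset crd 1 0; crd 0 1]%fset.
Proof.
case=> z z0 <-; apply/negP => /fset2P[|/(coord_affine_inj vw) z0'].
  exact: (coord_affine_infty vw).
by rewrite /= z0' eqxx in z0.
Qed.

Lemma act_coord (g : {'GL_2[k]}) v' w' x y : (x != 0) || (y != 0) ->
  map_mx iota (GLval g) *m v = v' -> map_mx iota (GLval g) *m w = w' ->
  act g (crd x y) = coord v' w' x y.
Proof.
by move=> xy <- <-; rewrite pt_GL2_act ?coord_neq0 // mulmxDr -!scalemxAr.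
Qed.

End Frame.

Lemma imfset_fixed1 (T : choiceType) (f : T -> T) a :
  f a = a -> [fset f x | x in [fset a]]%fset = [fset a]%fset.
Proof. by move=> fa; rewrite imfset_fset1 fa. Qed.

Lemma orbit_fixed1 (T : choiceType) (f : T -> T) (a : T) x y :
  x \in [fset a]%fset -> y \in [fset a]%fset -> exists i, y = iter i f x.
Proof. by move=> /fset1P -> /fset1P ->; exists 0%N. Qed.

Lemma fps_stable_atom (g : {'GL_2[k]}) (U : set (P1 K)) (F : {fset P1 K}) (P : {poly rat}) e f :
  (forall a, U a -> a \notin F) -> #|` F| = e -> (0 < e)%N ->
  [fset frobP1 x | x in F]%fset = F -> [fset act g x | x in F]%fset = F ->
  (forall x y, x \in F -> y \in F -> exists i, y = iter i frobP1 x) ->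
  (forall j, (Defs.card (stable_subsets frobP1 (act g) U j))%:R =
             fps_mul (fps_poly P) f j) ->
  forall n, (Defs.card (stable_subsets frobP1 (act g) (U `|` [set` F])%classic n))%:R =
            fps_mul (fps_poly ((1 + 'X^e) * P)) f n.
Proof.
move=> UF Fe e_gt0 Fs Fg Forb core n; rewrite fps_mul_poly1DXn -!core.
rewrite (card_stable_atom frobP1_inj (@GL2_act_inj g)) ?Fe //; last exact: finite_stable_P1.
by rewrite natrD; congr (_ + _); case: ifP.
Qed.

Section SplitSemisimple.
Variables (g : {'GL_2[k]}) (v w : 'cV[K]_2) (l m : K) (d : nat).
Hypotheses (vw : frame v w) (frob_v : map_mx frob v = v) (frob_w : map_mx frob w = w).
Hypotheses (m0 : m != 0) (gv : map_mx iota (GLval g) *m v = l *: v)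
  (gw : map_mx iota (GLval g) *m w = m *: w).
Hypothesis prim : d.-primitive_root (l / m).

Lemma fps_stable_split n :
  (Defs.card (stable_subsets frobP1 (act g) [set: P1 K]%classic n))%:R =
  fps_mul (fps_poly ((1 + 'X) ^+ 2)) (fps_dil d (fV frob Kstar)) n.
Proof.
have l0 : l != 0.
  apply/negP => /eqP l0; have := prim_order_gt0 prim.
  by rewrite lt0n -(prim_root_eq0 prim) l0 mul0r eqxx.
have act_aff z : act g (coord v w z 1) = coord v w (l / m * z) 1.
  rewrite (act_coord vw _ gv gw) ?oner_eq0 ?orbT //.
  rewrite -[RHS](coord_scale _ _ _ _ m0) /coord !scalerA mul1r mulr1.
  by congr (pt (_ *: _ + _)); field.
have act_inf : act g (coord v w 1 0) = coord v w 1 0.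
  rewrite (act_coord vw _ gv gw) ?oner_eq0 //.
  by rewrite -[RHS](coord_scale _ _ _ _ l0) /coord !scalerA !mulr1 mul1r mulr0 mul0r.
have act_zero : act g (coord v w 0 1) = coord v w 0 1 by rewrite act_aff mulr0.
have frob_aff := frobP1_affine vw frob_v frob_w.
have frob_zero : frobP1 (coord v w 0 1) = coord v w 0 1 by rewrite frob_aff frob0.
have frob_inf := frobP1_infty vw frob_v frob_w.
have core j : (Defs.card (stable_subsets frobP1 (act g)
    ((fun z => coord v w z 1) @` Kstar)%classic j))%:R =
    fps_dil d (fV frob Kstar) j.
  rewrite -(card_stable_kummer _ prim); first last.
  - by move=> x; rewrite /frob exprAC.
  - by move=> x y _ _; exact: (frob_inj iota).
  - by move=> x; rewrite frob_eq0.
  congr (_%:R); apply/esym/(card_stable_transport _ (e := fun z => coord v w z 1)) => //.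
  - by move=> x y _ _; exact: (coord_affine_inj vw).
  - by move=> x; rewrite /= frob_eq0.
  - move=> x; rewrite /= act_aff; split => //.
    by rewrite mulf_neq0 // mulf_neq0 ?invr_eq0.
(* The point 0 is adjoined here and the point at infinity next, each being a Frobenius orbit by
   itself. *)
have inner := fps_stable_atom (Kstar_notin_zero vw) (cardfs1 _) isT
  (imfset_fixed1 frob_zero) (imfset_fixed1 act_zero) (@orbit_fixed1 _ frobP1 _)
  (fun j => etrans (core j) (esym (fps_mul_poly1 _ j))).
have := fps_stable_atom (affine_notin_infty vw) (cardfs1 _) isT
  (imfset_fixed1 frob_inf) (imfset_fixed1 act_inf) (@orbit_fixed1 _ frobP1 _).
rewrite (affine_Kstar_cover v w) => /(_ _ _ inner n).
by rewrite -(affine_Kstar_cover v w) -(affine_cover vw) expr1 mulr1 expr2.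
Qed.

End SplitSemisimple.

Section Unipotent.
Variables (g : {'GL_2[k]}) (v w : 'cV[K]_2) (l : K) (p : nat).
Hypotheses (vw : frame v w) (frob_v : map_mx frob v = v) (frob_w : map_mx frob w = w).
Hypotheses (l0 : l != 0) (gv : map_mx iota (GLval g) *m v = l *: v)
  (gw : map_mx iota (GLval g) *m w = l *: (v + w)).
Hypothesis pK : p \in [pchar K].

Lemma fps_stable_unipotent n :
  (Defs.card (stable_subsets frobP1 (act g) [set: P1 K]%classic n))%:R =
  fps_mul (fps_poly (1 + 'X)) (fps_dil p (fV frob [set: K]%classic)) n.
Proof.
have act_aff z : act g (coord v w z 1) = coord v w (z + 1) 1.
  rewrite (act_coord vw _ gv gw) ?oner_eq0 ?orbT //.
  rewrite -[RHS](coord_scale _ _ _ _ l0) /coord mulr1 scale1r.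
  by congr pt; rewrite scalerDr addrA !scalerA -scalerDl; congr (_ *: _ + _); ring.
have act_inf : act g (coord v w 1 0) = coord v w 1 0.
  rewrite (act_coord vw _ gv gw) ?oner_eq0 //.
  by rewrite -[RHS](coord_scale _ _ _ _ l0) /coord !scalerA mulr1 mul1r mulr0 mul0r !scale0r.
have frob_aff := frobP1_affine vw frob_v frob_w.
have frob_inf := frobP1_infty vw frob_v frob_w.
have core j : (Defs.card (stable_subsets frobP1 (act g)
    ((fun z => coord v w z 1) @` [set: K])%classic j))%:R =
    fps_dil p (fV frob [set: K]%classic) j.
  rewrite -(card_stable_artin_schreier iota _ pK).
  congr (_%:R); apply/esym/(card_stable_transport _ (e := fun z => coord v w z 1)) => //.
  by move=> x y _ _; exact: (coord_affine_inj vw).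
have := fps_stable_atom (affine_notin_infty vw) (cardfs1 _) isT
  (imfset_fixed1 frob_inf) (imfset_fixed1 act_inf) (@orbit_fixed1 _ frobP1 _)
  (fun j => etrans (core j) (esym (fps_mul_poly1 _ j))).
by move=> /(_ n); rewrite -(affine_cover vw) expr1 mulr1.
Qed.

End Unipotent.

(* In the basis [v, Frob v] Frobenius reads [z |-> z^-q], whatever [v] is: the
   complements of all degree two orbits are the same twisted form of [K^*]. *)
Section NonSplit.
Variables (v w : 'cV[K]_2).
Hypotheses (vw : frame v w) (frob_v : map_mx frob v = w) (frob_w : map_mx frob w = v).
Notation axes := [fset coord v w 1 0; coord v w 0 1]%fset.

Lemma frobP1_swap x y : (x != 0) || (y != 0) ->
  frobP1 (coord v w x y) = coord v w (frob y) (frob x).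
Proof.
by move=> xy; rewrite pt_frobP1 ?coord_neq0 // map_frob_comb frob_v frob_w addrC.
Qed.

Lemma frobP1_inf_zero : frobP1 (coord v w 1 0) = coord v w 0 1.
Proof. by rewrite frobP1_swap ?oner_eq0 // frob1 frob0. Qed.

Lemma frobP1_zero_inf : frobP1 (coord v w 0 1) = coord v w 1 0.
Proof. by rewrite frobP1_swap ?oner_eq0 ?orbT // frob1 frob0. Qed.

Lemma frobP1_twisted z : z != 0 ->
  frobP1 (coord v w z 1) = coord v w (frob z)^-1 1.
Proof.
move=> z0; rewrite frobP1_swap ?z0 // frob1.
have fz0 : frob z != 0 by rewrite frob_eq0.
by rewrite -[RHS](coord_scale _ _ _ _ fz0) mulr1 divff.
Qed.

Lemma frob_axes : [fset frobP1 x | x in axes]%fset = axes.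
Proof.
apply: fset_stableP => [x y _ _|x /fset2P[->|->]]; first exact: frobP1_inj.
  by rewrite frobP1_inf_zero; exact: fset22.
by rewrite frobP1_zero_inf; exact: fset21.
Qed.

Lemma axes_orbit x y : x \in axes -> y \in axes -> exists i, y = iter i frobP1 x.
Proof.
move=> /fset2P[->|->] /fset2P[->|->].
- by exists 0%N.
- by exists 1%N; rewrite /= frobP1_inf_zero.
- by exists 1%N; rewrite /= frobP1_zero_inf.
- by exists 0%N.
Qed.

Lemma card_axes : #|` axes| = 2%N.
Proof.
rewrite cardfs2 (_ : _ != _) //; apply/eqP => /esym; exact: (coord_affine_infty vw).
Qed.

Notation twist := (fun z => (frob z)^-1).

Lemma twist_Kstar (x : K) : x != 0 -> (frob x)^-1 != 0.
Proof. by rewrite invr_eq0 frob_eq0. Qed.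

Lemma fV_twist n :
  fV frobP1 (~` [set` axes])%classic n = fV twist Kstar n.
Proof.
rewrite /fV !rational_subsetsE; congr (_%:R).
apply/esym/(card_stable_transport _ (e := fun z => coord v w z 1)) => //.
- by move=> x y _ _; exact: (coord_affine_inj vw).
- apply/seteqP; split => [a aK|a] /=; first exact/negP/(Kstar_notin_axes vw).
  move=> a_axes; have : [set: P1 K]%classic a by [].
  by rewrite (Kstar_cover vw) => -[|/a_axes].
- by move=> x x0; split; [exact: twist_Kstar|rewrite frobP1_twisted].
Qed.

(** The two fixed points of [g] form a single Frobenius orbit and are adjoined at once, which gives
    one factor 1 + x^2 instead of two factors 1 + x. *)
Lemma fps_stable_nonsplit (g : {'GL_2[k]}) (l m : K) (d n : nat) :
  m != 0 -> map_mx iota (GLval g) *m v = l *: v ->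
  map_mx iota (GLval g) *m w = m *: w -> d.-primitive_root (l / m) ->
  (Defs.card (stable_subsets frobP1 (act g) [set: P1 K]%classic n))%:R =
  fps_mul (fps_poly (1 + 'X^2)) (fps_dil d (fV twist Kstar)) n.
Proof.
move=> m0 gv gw prim; have l0 : l != 0.
  apply/negP => /eqP l0; have := prim_order_gt0 prim.
  by rewrite lt0n -(prim_root_eq0 prim) l0 mul0r eqxx.
have act_aff z : act g (coord v w z 1) = coord v w (l / m * z) 1.
  rewrite (act_coord vw _ gv gw) ?oner_eq0 ?orbT //.
  rewrite -[RHS](coord_scale _ _ _ _ m0) /coord !scalerA mul1r mulr1.
  by congr (pt (_ *: _ + _)); field.
have act_inf : act g (coord v w 1 0) = coord v w 1 0.
  rewrite (act_coord vw _ gv gw) ?oner_eq0 //.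
  by rewrite -[RHS](coord_scale _ _ _ _ l0) /coord !scalerA !mulr1 mul1r mulr0 mul0r.
have act_axes : [fset act g x | x in axes]%fset = axes.
  apply: fset_stableP => [x y _ _|x /fset2P[->|->]]; first exact: GL2_act_inj.
    by rewrite act_inf; exact: fset21.
  by rewrite act_aff mulr0; exact: fset22.
have core j : (Defs.card (stable_subsets frobP1 (act g)
    ((fun z => coord v w z 1) @` Kstar)%classic j))%:R =
    fps_dil d (fV twist Kstar) j.
  rewrite -(card_stable_kummer _ prim).
  - congr (_%:R); apply/esym/(card_stable_transport _ (e := fun z => coord v w z 1)) => //.
    + by move=> x y _ _; exact: (coord_affine_inj vw).
    + by move=> x x0; split; [exact: twist_Kstar|rewrite frobP1_twisted].
    + move=> x; rewrite /= act_aff; split => //.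
      by rewrite mulf_neq0 // mulf_neq0 ?invr_eq0.
  - exact: twist_Kstar.
  - by move=> x y _ _ /invr_inj/(frob_inj iota).
  - by move=> x; rewrite /frob exprAC exprVn.
have := fps_stable_atom (Kstar_notin_axes vw) card_axes isT
  frob_axes act_axes axes_orbit (fun j => etrans (core j) (esym (fps_mul_poly1 _ j))).
by move=> /(_ n); rewrite -(Kstar_cover vw) mulr1.
Qed.

End NonSplit.

(** Such a point is [z : 1] with z outside [k] and fixed by the square of Frobenius; the vectors (z,
    1) and (z^q, 1) have determinant z - z^q and are exchanged by Frobenius. *)
Lemma degree2_frame (P : P1 K) : degree k P = 2%N ->
  exists v w, [/\ frame v w, map_mx frob v = w, map_mx frob w = v &
    frob_orbit k P = [set` [fset coord v w 1 0; coord v w 0 1]%fset]%classic].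
Proof.
rewrite /degree => orb2.
have fin : finite_set (frob_orbit k P).
  by apply: contrapT => /card_infinite; rewrite orb2.
have orb i : iter i frobP1 P \in fset_set (frob_orbit k P).
  by rewrite in_fset_set // inE; exists i.
have P1P : frobP1 P <> P.
  move=> E; move: orb2; suff -> : frob_orbit k P = [set P]%classic.
    by rewrite /Defs.card fset_set1 cardfs1.
  apply/seteqP; split => [_ [i ->]|_ ->]; last by exists 0%N.
  by elim: i => //= i ->.
(* Otherwise the orbit would contain three distinct points. *)
have P2P : frobP1 (frobP1 P) = P.
  apply: contrapT => P2P.
  have : (frobP1 (frobP1 P) |` [fset P; frobP1 P] `<=` fset_set (frob_orbit k P))%fset.
    apply/fsubsetP => a /fset1UP[->|/fset2P[->|->]].
    - exact: (orb 2%N).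
    - exact: (orb 0%N).
    - exact: (orb 1%N).
  move/fsubset_leq_card; rewrite -/(Defs.card _) orb2 cardfsU1 cardfs2.
  have -> : P != frobP1 P by apply/eqP => /esym.
  suff -> : frobP1 (frobP1 P) \notin [fset P; frobP1 P]%fset by [].
  by apply/negP => /fset2P[//|/frobP1_inj].
have aff := frobP1_affine std_frame frob_std0 frob_std1.
have inf := frobP1_infty std_frame frob_std0 frob_std1.
(* The point at infinity is rational, hence not of degree two. *)
case: (coord_surj std_frame P) => [PE|[z PE]]; first by case: P1P; rewrite PE inf.
move: P1P P2P; rewrite PE !aff => zq /(coord_affine_inj std_frame) zqq.
have comb x : map_mx frob (x *: std0 + 1 *: std1) = frob x *: std0 + 1 *: std1.
  by rewrite map_frob_comb frob_std0 frob_std1 frob1.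
set v := z *: std0 + 1 *: std1; set w := frob z *: std0 + 1 *: std1.
have vw : frame v w.
  rewrite /frame !mxE /= !mulr1 !mulr0 !addr0 !add0r !mulr1 mul1r subr_eq0.
  by apply/negP => /eqP zE; apply: zq; rewrite -zE.
have fv : map_mx frob v = w by exact: comb.
have fw : map_mx frob w = v by rewrite /w comb zqq.
have PE' : coord std0 std1 z 1 = coord v w 1 0 by rewrite [RHS]/coord (scale1r v) scale0r addr0.
exists v, w; split; rewrite ?PE' //.
apply/seteqP; split => [a [i ->]|a /fset2P[->|->]]; last 2 first.
- by exists 0%N.
- by exists 1%N; rewrite /= (frobP1_inf_zero vw).
by apply: fset_stable_iter; [exact: frob_axes|exact: fset21].
Qed.

Lemma fV_degree2 (P : P1 K) n : degree k P = 2%N ->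
  fV frobP1 (~` frob_orbit k P)%classic n = fV (fun z => (frob z)^-1) Kstar n.
Proof. by move=> /degree2_frame[v [w [vw fv fw ->]]]; exact: fV_twist. Qed.

(** Translation by a point of [k] commutes with Frobenius, so the removed point may be taken to be
    0. *)
Lemma fV_punctured_line (star : k) n :
  fV frob (~` [set iota star])%classic n = fV frob Kstar n.
Proof.
rewrite /fV !rational_subsetsE; congr (_%:R).
apply/esym/(card_stable_transport _ (e := fun z => z + iota star)) => //.
- by move=> x y _ _; exact: addIr.
- apply/seteqP; split => [_ [x x0 <-] /= /eqP|x /= xs].
    by rewrite -subr_eq0 addrK (negPf x0).
  by exists (x - iota star); rewrite ?subrK //= subr_eq0; apply/eqP.
- by move=> x x0; rewrite /= frob_eq0 (frobD iota) frob_iota.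
Qed.

End Geometry.

(** * Counting matrices *)

Lemma ord2E (i : 'I_2) : (i == 0) || (i == 1).
Proof. by case: i => -[|[|]]. Qed.

Lemma mxtrace2 (F : nzRingType) (M : 'M[F]_2) : \tr M = M 0 0 + M 1 1.
Proof. by rewrite /mxtrace !big_ord_recl big_ord0 addr0; congr (_ + M _ _); apply/val_inj. Qed.

Lemma det2 (F : comNzRingType) (M : 'M[F]_2) : \det M = M 0 0 * M 1 1 - M 0 1 * M 1 0.
Proof.
rewrite (expand_det_row _ 0) !big_ord_recl big_ord0 addr0 /cofactor !det_mx11 !mxE /=.
have -> : lift 0 0 = 1 :> 'I_2 by apply/val_inj.
have -> : lift 1 0 = 0 :> 'I_2 by apply/val_inj.
by rewrite expr0 expr1 mul1r mulN1r mulrN.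
Qed.

Lemma char_poly2_root (F : comNzRingType) (M : 'M[F]_2) a :
  root (char_poly M) a = (a ^+ 2 - \tr M * a + \det M == 0).
Proof.
have -> : char_poly M = 'X^2 - (\tr M)%:P * 'X + (\det M)%:P.
  have m := char_poly_monic M; have s := size_char_poly M.
  apply/polyP => -[|[|[|i]]]; rewrite ![in RHS]coefE /=.
  - by rewrite char_poly_det sqrrN expr1n mul1r mulr0 subr0 add0r.
  - by rewrite -[1%N]/(2.-1) char_poly_trace // sub0r mulr1 addr0.
  - by move/monicP: m; rewrite lead_coefE s /= => ->; rewrite mulr0 subr0 addr0.
  - by rewrite nth_default ?s // mulr0 subr0 addr0.
by rewrite rootE !hornerE.
Qed.

(** Vieta. The two root equations differ by (a - b)(a + b - tr M), so distinctness yields the trace,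
    and then the determinant. *)
Lemma char_poly2_tr_det (F : idomainType) (M : 'M[F]_2) a b : a != b ->
  root (char_poly M) a && root (char_poly M) b = (\tr M == a + b) && (\det M == a * b).
Proof.
move=> ab; rewrite !char_poly2_root; apply/andP/andP => -[/eqP Ea /eqP Eb]; last first.
  by rewrite Ea Eb; split; apply/eqP; ring.
have trE : \tr M = a + b.
  have : (a - b) * (a + b - \tr M) = 0.
    transitivity ((a ^+ 2 - \tr M * a + \det M) - (b ^+ 2 - \tr M * b + \det M)).
      by ring.
    by rewrite Ea Eb subrr.
  by move/eqP; rewrite mulf_eq0 !subr_eq0 (negPf ab) => /eqP ->.
split; apply/eqP => //.
by have /eqP := Ea; rewrite addrC addr_eq0 trE => /eqP ->; ring.
Qed.

Section Count.
Variable k : finFieldType.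
Notation q := #|k|.

Definition nroots (t m : k) := #|[set a : k | a ^+ 2 - t * a + m == 0]|.

(** Each nonzero b has exactly one partner c, while b = 0 has q partners if s = 0 and none
    otherwise. *)
Lemma card_mul_eq (s : k) : (\sum_(b : k) \sum_(c : k) ((b * c)%R == s) = q.-1 + (s == 0%R) * q)%N.
Proof.
rewrite (bigD1 0) //= addnC; congr addn.
  rewrite (eq_bigr (fun=> 1%N)) => [|b b0]; first by rewrite sum1_card (cardC1 0).
  rewrite (bigD1 (s / b)) //= [b * _]mulrC divfK // eqxx big1 ?addn0 // => c cs.
  by apply/eqP; rewrite eqb0; apply: contra cs => /eqP <-; rewrite [b * c]mulrC mulfK.
rewrite (eq_bigr (fun=> (s == 0) : nat)) => [|c _]; last by rewrite mul0r eq_sym.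
by rewrite sum_nat_const mulnC.
Qed.

(** With diagonal (a, t - a), the off-diagonal entries must have product a(t - a) - m, and this
    vanishes exactly when a is a root of X^2 - tX + m. *)
Lemma card_tr_det (t m : k) :
  #|[set M : 'M[k]_2 | (\tr M == t) && (\det M == m)]| = (q * q.-1 + nroots t m * q)%N.
Proof.
pose mk (x : k * (k * k)) : 'M[k]_2 := \matrix_(i, j)
  if i == 0 then if j == 0 then x.1 else x.2.1 else if j == 0 then x.2.2 else t - x.1.
have mk_inj : injective mk.
  move=> [a [b c]] [a' [b' c']] /matrixP E.
  by have := E 0 0; have := E 0 1; have := E 1 0; rewrite !mxE /= => -> -> ->.
have -> : [set M : 'M[k]_2 | (\tr M == t) && (\det M == m)] =
    mk @: [set x | x.2.1 * x.2.2 == x.1 * (t - x.1) - m].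
  apply/setP => M; rewrite inE; apply/andP/imsetP => [[/eqP tM /eqP dM]|[[a [b c]]]].
    exists (M 0 0, (M 0 1, M 1 0)); rewrite ?inE /=.
      by rewrite -tM -dM mxtrace2 det2; apply/eqP; ring.
    apply/matrixP => i j; rewrite mxE -tM mxtrace2 /=.
    case/orP: (ord2E i) => /eqP ->; case/orP: (ord2E j) => /eqP -> //=.
    by rewrite addrAC subrr add0r.
  rewrite inE /= => /eqP E ->; rewrite mxtrace2 det2 !mxE /= E.
  by split; apply/eqP; ring.
rewrite card_imset // -sum1_card big_mkcond /=.
under eq_bigr => x _ do rewrite inE -[if _ then _ else _]/(nat_of_bool _).
rewrite -(pair_big predT predT (fun a x => (x.1 * x.2 == a * (t - a) - m : nat))) /=.
under eq_bigr => a _ do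
  rewrite -(pair_big predT predT (fun b c => (b * c == a * (t - a) - m : nat))) /= card_mul_eq.
rewrite big_split /= sum_nat_const; congr addn.
rewrite -big_distrl /=; congr muln; rewrite /nroots -sum1_card [RHS]big_mkcond /=.
apply: eq_bigr => a _; rewrite inE -[in RHS]oppr_eq0.
by rewrite (_ : - (a ^+ 2 - t * a + m) = a * (t - a) - m) //; ring.
Qed.

Lemma card_GL_tr_det (t m : k) : m != 0 ->
  #|[set g : {'GL_2[k]} | (\tr (GLval g) == t) && (\det (GLval g) == m)]| =
  (q * q.-1 + nroots t m * q)%N.
Proof.
move=> m0; rewrite -card_tr_det -(card_imset _ (val_inj : injective (@GLval 2 k))).
apply: eq_card => M; rewrite inE; apply/imsetP/andP => [[g]|[tM /eqP dM]].
  by rewrite inE => /andP[? ?] ->.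
have MU : M \in unitmx by rewrite unitmxE dM unitfE.
by exists (Sub M MU : {'GL_2[k]}); rewrite ?SubK // inE /= tM dM /=.
Qed.

End Count.

(** * Sums over finite groups and roots of unity *)

(** Related pairs (g, j) are summed with their common weight [f g = h j]: each [g] lies in [e] pairs
    and each [j] in [c] of them. In the applications [g] is a matrix and [j] encodes its
    eigenvalues. *)
Lemma double_count (G J : finType) (P : pred G) (Q : pred J) (R : G -> J -> bool)
    (f : G -> rat) (h : J -> rat) (c e : nat) :
  (forall g j, P g && R g j = Q j && R g j) ->
  (forall g, P g -> #|[set j | Q j && R g j]| = e) ->
  (forall j, Q j -> #|[set g | R g j]| = c) ->
  (forall g j, Q j -> R g j -> f g = h j) ->
  e%:R * \sum_(g | P g) f g = c%:R * \sum_(j | Q j) h j.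
Proof.
move=> PQ cardJ cardG fh.
transitivity (\sum_(g | P g) \sum_(j | Q j && R g j) f g).
  rewrite mulr_sumr; apply: eq_bigr => g Pg.
  by rewrite sumr_const mulr_natl -(cardJ g Pg); congr (_ *+ _); apply: eq_card => j; rewrite inE.
rewrite (exchange_big_dep Q) /=; last by move=> g j _ /andP[].
rewrite mulr_sumr; apply: eq_bigr => j Qj.
rewrite (eq_bigl (fun g => R g j)) => [|g]; last first.
  by rewrite Qj andTb PQ Qj.
rewrite (eq_bigr (fun=> h j)) => [|g Rg]; last exact: fh.
by rewrite sumr_const mulr_natl -(cardG j Qj); congr (_ *+ _); apply: eq_card => g; rewrite inE.
Qed.

(** The class of x has |G| / |C_G(x)| elements, so weighting representatives by inverse centralizer
    orders amounts to averaging over the group. *)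
Lemma sum_class_representatives (gT : finGroupType) (G : {group gT}) (C : {set gT})
    (P : pred gT) (F : gT -> rat) :
  is_transversal C (classes G) G ->
  {in G &, forall x y, P (x ^ y)%g = P x} -> {in G &, forall x y, F (x ^ y)%g = F x} ->
  \sum_(x in C | P x) (#|'C_G[x]%g|%:R)^-1 * F x = (#|G|%:R)^-1 * \sum_(x in G | P x) F x.
Proof.
move=> trC PJ FJ; have part := classes_partition G.
rewrite [in RHS]big_mkcondr (set_partition_big _ part) /=.
rewrite -(pblock_transversal trC) big_imset /=; last exact: pblock_inj trC.
rewrite mulr_sumr [LHS]big_mkcondr; apply: eq_bigr => x xC.
have xG : x \in G := fintype.subsetP (transversal_sub trC) x xC.
have -> : finset.pblock (classes G) x = (x ^: G)%g.
  by apply: (def_pblock (partition_trivIset part)); [exact: mem_classes|exact: class_refl].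
rewrite (eq_bigr (fun=> if P x then F x else 0)) => [|_ /imsetP[y yG ->]]; last first.
  by rewrite PJ // FJ.
case: ifP => _; last by rewrite big1 ?mulr0.
rewrite sumr_const -index_cent1 -(mulr_natl (F x)) mulrA; congr (_ * _).
have C0 : (#|'C_G[x]%g|%:R : rat) != 0 by rewrite Num.Theory.pnatr_eq0 -lt0n cardG_gt0.
have G0 : (#|G|%:R : rat) != 0 by rewrite Num.Theory.pnatr_eq0 -lt0n cardG_gt0.
apply: (mulfI G0); rewrite mulVKf // -(Lagrange (subsetIl G 'C[x]%g)) natrM.
by rewrite [_%:R * _]mulrC mulfK.
Qed.

Lemma sum_quotient (gT : finGroupType) (G H : {group gT}) (P : pred (coset_of H))
    (F : coset_of H -> rat) :
  (H <| G)%g ->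
  \sum_(g in G | P (coset H g)) F (coset H g) =
  #|H|%:R * \sum_(x in (G / H)%g | P x) F x.
Proof.
move=> /andP[sHG nHG]; rewrite (partition_big (coset H) (fun x => (x \in (G / H)%g) && P x)) /=.
  rewrite mulr_sumr; apply: eq_bigr => x /andP[xGH Px].
  rewrite (eq_bigr (fun=> F x)) => [|g /andP[_ /eqP ->] //].
  rewrite sumr_const mulr_natl; congr (_ *+ _).
  case/imsetP: xGH => g; rewrite inE => /andP[gN gG] xE; rewrite xE in Px *.
  rewrite -(card_rcoset H g); apply: eq_card => h; rewrite unfold_in /=.
  apply/andP/idP => [[/andP[hG _] /eqP E]|hg].
    by rewrite -val_coset // -E val_coset ?rcoset_refl // (fintype.subsetP nHG).
  have hG : h \in G by case/rcosetP: hg => y yH ->; rewrite groupM // (fintype.subsetP sHG).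
  have E : coset H h = coset H g.
    by apply/rcoset_kercosetP => //; rewrite (fintype.subsetP nHG).
  by rewrite hG E Px eqxx.
move=> g /andP[gG Pg]; rewrite Pg andbT mem_quotient //.
Qed.

(** With c = m/d, the indices i such that gcd(i, m) = c are the c j with j < d prime to d. *)
Lemma card_gcd_eq m d : (0 < m)%N -> (d %| m)%N ->
  #|[set i : 'I_m | m %/ gcdn i m == d]%N| = totient d.
Proof.
move=> m_gt0 /dvdnP[c mE].
have [c_gt0 d_gt0] : (0 < c /\ 0 < d)%N by apply/andP; rewrite -muln_gt0 -mE.
have lt_cj (j : 'I_d) : (c * j < m)%N by rewrite mE ltn_pmul2l.
pose f (j : 'I_d) : 'I_m := Ordinal (lt_cj j).
have f_inj : injective f.
  by move=> i j /(congr1 val) /eqP; rewrite /= eqn_pmul2l // => /eqP E; exact: val_inj.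
have -> : [set i : 'I_m | m %/ gcdn i m == d]%N = f @: [set j : 'I_d | coprime d j].
  apply/setP => i; rewrite inE; apply/idP/imsetP => [/eqP gE|[j]]; last first.
    rewrite inE => jd ->; rewrite /= {2}mE -muln_gcdr gcdnC (eqP jd) muln1.
    by rewrite mE mulKn.
  have gc : gcdn i m = c.
    have E : (d * gcdn i m = m)%N by rewrite -gE divnK ?dvdn_gcdr.
    by apply/eqP; rewrite -(eqn_pmul2l d_gt0) E mulnC -mE.
  have /dvdnP[j iE] : (c %| i)%N by rewrite -gc dvdn_gcdl.
  have lt_jd : (j < d)%N by rewrite -(ltn_pmul2l c_gt0) -mE mulnC -iE.
  exists (Ordinal lt_jd); last by apply/val_inj; rewrite /= mulnC.
  rewrite inE /= /coprime -(eqn_pmul2l c_gt0) muln_gcdr -mE mulnC -iE gcdnC gc.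
  by rewrite muln1.
rewrite card_imset // -sum1_card totient_count_coprime big_mkord [LHS]big_mkcond /=.
by apply: eq_bigr => j _; rewrite inE; case: coprime.
Qed.

(** m / gcd(i, m) is the order of the i-th power of a primitive m-th root of unity. The excluded
    index 0 is the one of order 1, which matches d > 1. *)
Lemma sum_order_totient (H : nat -> rat) m : (0 < m)%N ->
  \sum_(i < m | ~~ (m %| i)%N) H (m %/ gcdn i m)%N =
  \sum_(d <- divisors m | (1 < d)%N) (totient d)%:R * H d.
Proof.
move=> m_gt0.
rewrite (eq_bigl (fun i : 'I_m =>
    (m %/ gcdn i m)%N \in [seq d <- divisors m | (1 < d)%N])); last first.
  move=> i; rewrite mem_filter -dvdn_divisors // dvdn_div ?dvdn_gcdr // andbT.
  rewrite ltn_divRL ?dvdn_gcdr // mul1n ltn_neqAle dvdn_leq ?dvdn_gcdr // andbT.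
  by congr negb; apply/gcdn_idPr/eqP.
rewrite -[RHS]big_filter; move: (filter_uniq (fun d => 1 < d)%N (divisors_uniq m)).
have : all (dvdn^~ m) [seq d <- divisors m | (1 < d)%N].
  by apply/allP => d; rewrite mem_filter -dvdn_divisors // => /andP[].
elim: [seq d <- _ | _] => [|d s IH] /=; first by rewrite big_nil big_pred0.
move=> /andP[dm sm] /andP[ds us]; rewrite big_cons -IH //.
rewrite (bigID (fun i : 'I_m => m %/ gcdn i m == d)%N) /=; congr (_ + _).
  rewrite -(card_gcd_eq m_gt0 dm) mulr_natl -sumr_const.
  rewrite (eq_bigl (fun i => i \in [set i : 'I_m | m %/ gcdn i m == d]%N)).
    by apply: eq_bigr => i; rewrite inE => /eqP ->.
  by move=> i; rewrite !inE; case: eqP => [->|]; rewrite ?eqxx ?andbF.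
apply: eq_bigl => i; rewrite inE; case: eqP => [->|_] /=; first by rewrite (negPf ds).
by rewrite andbT.
Qed.

(** The summand depends on i modulo m only, and the range consists of [s] full periods. *)
Lemma sum_order_totient_mul (H : nat -> rat) s m : (0 < m)%N ->
  \sum_(i < s * m | ~~ (m %| i)%N) H (m %/ gcdn i m)%N =
  s%:R * \sum_(d <- divisors m | (1 < d)%N) (totient d)%:R * H d.
Proof.
move=> m_gt0; rewrite -sum_order_totient //.
rewrite -!(big_mkord (fun i => ~~ (m %| i)%N) (fun i => H (m %/ gcdn i m)%N)).
elim: s => [|s IH]; first by rewrite mul0n big_geq // mul0r.
rewrite mulSnr (big_cat_nat _ (n := s * m)) ?leq_addr //= IH -natr1 mulrDl mul1r; congr (_ + _).
rewrite -{1}[(s * m)%N]add0n big_addn addKn; apply: eq_big => i.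
  by rewrite dvdn_addl // dvdn_mull.
by move=> _; rewrite gcdnC addnC gcdnMDl gcdnC.
Qed.

(** When n is invertible X^n - 1 is separable, so it has n distinct roots, and n distinct n-th roots
    of unity include a primitive one. *)
Lemma closed_field_prim_root (K : closedFieldType) n : n%:R != 0 :> K ->
  exists z : K, n.-primitive_root z.
Proof.
move=> n0; have n_gt0 : (0 < n)%N by case: n n0 => //; rewrite eqxx.
have [r rE] := closed_field_poly_normal ('X^n - 1 : {poly K}).
have lc : lead_coef ('X^n - 1 : {poly K}) = 1 by apply/monicP/monic_Xn_sub_1.
rewrite lc scale1r in rE.
have ur : uniq r by rewrite -separable_prod_XsubC -rE separable_Xn_sub_1.
have : has n.-primitive_root r.
  apply: has_prim_root => //.
    by apply/allP => z zr; rewrite unity_rootE -subr_eq0; have := root_prod_XsubC r z;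
       rewrite -rE zr rootE !hornerE.
  by rewrite -ltnS -(size_prod_XsubC r id) -rE size_XnsubC.
by case/hasP => z _; exists z.
Qed.

(** * Types of matrices *)

(** [eigenvalue] concerns row vectors, whereas points are columns; transposition preserves trace and
    determinant, hence the roots. *)
Lemma char_poly2_eigenvector (F : fieldType) (M : 'M[F]_2) a :
  root (char_poly M) a -> exists2 v : 'cV_2, v != 0 & M *m v = a *: v.
Proof.
rewrite char_poly2_root -mxtrace_tr -det_tr -char_poly2_root -eigenvalue_root_char.
case/eigenvalueP => v vM v0; exists v^T; last by rewrite -[M]trmxK -trmx_mul vM linearZ.
by rewrite -trmx0 (inj_eq trmx_inj).
Qed.

Lemma eigenvectors_frame (F : fieldType) (M : 'M[F]_2) (v w : 'cV_2) a b :
  a != b -> v != 0 -> w != 0 -> M *m v = a *: v -> M *m w = b *: w -> frame v w.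
Proof.
move=> ab v0 w0 Mv Mw; apply: frameP => // c; apply: contra w0 => /eqP wE.
have /eqP : (a - b) *: w = 0.
  by rewrite scalerBl -Mw wE -scalemxAr Mv !scalerA mulrC subrr.
by rewrite scaler_eq0 subr_eq0 (negPf ab).
Qed.

(** By Cayley-Hamilton the columns of M - a' are killed by M - a, where a' = tr M - a is the other
    root; this is the first one. Its entries are polynomial in a with coefficients among those of M,
    so conjugate eigenvalues receive conjugate vectors. It may vanish. *)
Lemma char_poly2_explicit_eigenvector (F : fieldType) (M : 'M[F]_2) a :
  root (char_poly M) a -> M *m (\col_i (if i == 0 then a - M 1 1 else M 1 0)) =
    a *: (\col_i (if i == 0 then a - M 1 1 else M 1 0)).
Proof.
rewrite char_poly2_root mxtrace2 det2 => /eqP aE; apply: colP2.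
  rewrite !mxE !big_ord_recl big_ord0 !mxE /= (_ : lift 0 0 = 1); last exact/val_inj.
  by rewrite -[RHS]subr0 -[X in _ = _ - X]aE; ring.
rewrite !mxE !big_ord_recl big_ord0 !mxE /= (_ : lift 0 0 = 1); last exact/val_inj.
ring.
Qed.

(** The factor [a] in front of [v + w] normalizes the frame so that M acts on the affine coordinate
    as z |-> z + 1 exactly. *)
Lemma char_poly2_unipotent (F : fieldType) (M : 'M[F]_2) a :
  a != 0 -> \tr M = a *+ 2 -> \det M = a ^+ 2 -> ~~ is_scalar_mx M ->
  exists v w : 'cV_2, [/\ frame v w, M *m v = a *: v & M *m w = a *: (v + w)].
Proof.
move=> a0; rewrite mxtrace2 det2 => trM detM Msc.
(* [N] is nilpotent and nonzero: pick [w] with [N w != 0] and [v = N w / a]. *)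
pose N := M - a%:M.
have NN : N *m N = 0.
  have E1 : M 1 1 = a *+ 2 - M 0 0 by rewrite -trM addrC addKr.
  have E2 : M 0 1 * M 1 0 = M 0 0 * M 1 1 - a ^+ 2 by rewrite -detM; ring.
  apply/matrixP => i j; rewrite !mxE !big_ord_recl big_ord0 !mxE.
  rewrite (_ : lift 0 0 = 1); last exact/val_inj.
  case/orP: (ord2E i) => /eqP ->; case/orP: (ord2E j) => /eqP -> /=.
  - transitivity ((M 0 0 - a) ^+ 2 + M 0 1 * M 1 0); first by ring.
    by rewrite E2 E1; ring.
  - by rewrite E1; ring.
  - by rewrite E1; ring.
  - transitivity ((M 1 1 - a) ^+ 2 + M 0 1 * M 1 0); first by ring.
    by rewrite E2 E1; ring.
have [j Nj] : exists j, col j N != 0.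
  apply/existsP; rewrite -negb_forall; apply: contra Msc => /forallP N0.
  apply/is_scalar_mxP; exists a; apply/subr0_eq/matrixP => i j.
  by have /eqP/matrixP/(_ i 0) := N0 j; rewrite !mxE.
pose w := delta_mx j 0 : 'cV[F]_2.
have Nw : N *m w = col j N by rewrite -colE.
have Nv : N *m (a^-1 *: (N *m w)) = 0 by rewrite -scalemxAr mulmxA NN mul0mx scaler0.
have ME u : M *m u = N *m u + a *: u by rewrite mulmxBl mul_scalar_mx subrK.
exists (a^-1 *: (N *m w)), w; split.
- apply: frameP; first by rewrite scaler_eq0 invr_eq0 (negPf a0) Nw.
  move=> c; apply: contra Nj => /eqP E; rewrite -Nw E -scalemxAr Nv scaler0 //.
- by rewrite ME Nv add0r.
- by rewrite ME scalerDr scalerA divff // scale1r.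
Qed.

Section Types.
Variable k : finFieldType.

Definition nroots_mx (M : 'M[k]_2) := nroots (\tr M) (\det M).

Lemma nroots_mxE M : nroots_mx M = #|[set a | root (char_poly M) a]|.
Proof. by apply: eq_card => a; rewrite !inE char_poly2_root. Qed.

Lemma nroots_mx_le2 M : (nroots_mx M <= 2)%N.
Proof.
rewrite nroots_mxE cardE -ltnS -(size_char_poly M).
apply: max_poly_roots; [exact/monic_neq0/char_poly_monic| |exact: enum_uniq].
by apply/allP => a; rewrite mem_enum inE.
Qed.

(** A decidable form of the types: the number of eigenvalues in [k], with the scalar matrices set
    apart among those that have one. *)
Definition mx_type (T : elt_type) (M : 'M[k]_2) : bool :=
  match T with
  | TypeA => nroots_mx M == 0%N
  | TypeB => (nroots_mx M == 1%N) && ~~ is_scalar_mx M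
  | TypeC => nroots_mx M == 2%N
  | TypeD => is_scalar_mx M
  end.

Lemma mx_has_typeP T M : mx_has_type T M <-> mx_type T M.
Proof.
have sM := size_char_poly M.
case: T => /=; rewrite ?nroots_mxE.
- split=> [[_ irr]|/eqP/cards0_eq noroot].
    rewrite cards_eq0; apply/eqP/setP => a; rewrite !inE; apply/negP => ra.
    have /eqp_size : 'X - a%:P %= char_poly M.
      by apply: irr; [rewrite size_XsubC|rewrite dvdp_XsubCl].
    by rewrite size_XsubC sM.
  (* A polynomial of degree two without roots is irreducible. *)
  apply: cubic_irreducible; first by rewrite sM.
  by move=> a; have /setP/(_ a) := noroot; rewrite !inE => ->.
- split=> [[nd [a aP]]|/andP[/cards1P[a aE] nsc]].
    apply/andP; split.
      apply/cards1P; exists a; apply/setP => b; rewrite !inE -eigenvalue_root_char.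
      by apply/idP/eqP => /aP.
    apply/negP => /is_scalar_mxP[c ME]; apply: nd; exists 1%:M; first exact: unitmx1.
    apply/(diagonalizable_forP _ (unitmx1 _ _)) => i j ij.
    by rewrite mul1mx invmx1 mulmx1 ME mxE (negPf (ij : i != j)) mulr0n.
  have eigE b : eigenvalue M b = (b == a).
    by rewrite eigenvalue_root_char; have /setP/(_ b) := aE; rewrite !inE.
  split; last by exists a => b; rewrite eigE; split => /eqP.
  case=> Q QU /diagonalizable_forPex[D /(simmxP QU) QM].
  (* The rows of [Q] are eigenvectors, so every diagonal entry of [D] is the single eigenvalue [a];
     [D], and with it [M], is then scalar. *)
  have Da i : D 0 i = a.
    apply/eqP; rewrite -eigE; apply/eigenvalueP; exists (row i Q).
      by rewrite -row_mul QM row_mul row_diag_mx -scalemxAl -rowE.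
    apply: contraTneq QU => Qi; rewrite unitmxE (expand_det_row _ i) big1 ?unitr0 // => j _.
    by have /matrixP/(_ 0 j) := Qi; rewrite !mxE => ->; rewrite mul0r.
  case/negP: nsc; apply/is_scalar_mxP; exists a.
  apply: (can_inj (mulKmx QU)); rewrite QM scalar_mxC; congr (_ *m _).
  by apply/matrixP => i j; rewrite !mxE Da.
- split=> [[a [b [ab ea eb]]]|/cards2P[a [b [ab E]]]].
    rewrite eqn_leq -nroots_mxE nroots_mx_le2 nroots_mxE.
    apply: (@leq_trans #|[set a; b]|); first by rewrite cards2 ab.
    apply: subset_leq_card; apply/fintype.subsetP => c; rewrite !inE.
    by rewrite -eigenvalue_root_char => /orP[/eqP ->|/eqP ->].
  exists a, b; rewrite !eigenvalue_root_char; have /setP E' := E.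
  by split=> //; [have := E' a|have := E' b]; rewrite !inE eqxx ?orbT.
- by [].
Qed.

End Types.

(** * Fixed sets in terms of the eigenvalues of a matrix *)

Section FixedCounts.
Variables (k : finFieldType) (K : closedFieldType) (iota : {rmorphism k -> K}).
Notation q := #|k|.
Notation frob := (@frob k K).
Notation frobP1 := (@frobP1 k K).
Notation Kstar := [set x : K | x != 0]%classic.
Implicit Types (g : {'GL_2[k]}) (n d : nat).

Definition fixed_count g : fps := fun n =>
  (Defs.card (stable_subsets frobP1 (GL2_act iota g) [set: P1 K]%classic n))%:R.

Definition split_series d : fps :=
  fps_mul (fps_poly ((1 + 'X) ^+ 2)) (fps_dil d (fV frob Kstar)).

Definition nonsplit_series d : fps :=
  fps_mul (fps_poly (1 + 'X^2)) (fps_dil d (fV (fun z => (frob z)^-1) Kstar)).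

Lemma frame_map (v w : 'cV[k]_2) : frame v w -> frame (map_mx iota v) (map_mx iota w).
Proof. by rewrite /frame !mxE -!rmorphM -rmorphB fmorph_eq0. Qed.

Lemma map_mx_eigen (M : 'M[k]_2) (v w : 'cV[k]_2) a :
  M *m v = a *: w -> map_mx iota M *m map_mx iota v = iota a *: map_mx iota w.
Proof. by move=> E; rewrite -map_mxM E map_mxZ. Qed.

Lemma GL_root_neq0 g a : root (char_poly (GLval g)) a -> a != 0.
Proof.
rewrite char_poly2_root; apply: contraTneq => ->.
by rewrite expr0n mulr0 subr0 add0r -unitfE -unitmxE; exact: (valP g).
Qed.

Lemma fixed_count_split g a b d n : a != b ->
  root (char_poly (GLval g)) a -> root (char_poly (GLval g)) b ->
  d.-primitive_root (a / b) -> fixed_count g n = split_series d n.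
Proof.
move=> ab ra rb prim.
have [v v0 gv] := char_poly2_eigenvector ra.
have [w w0 gw] := char_poly2_eigenvector rb.
apply: (fps_stable_split (frame_map (eigenvectors_frame ab v0 w0 gv gw))
  (map_frob_iota _ _) (map_frob_iota _ _) _ (map_mx_eigen gv) (map_mx_eigen gw)).
- by rewrite fmorph_eq0 (GL_root_neq0 rb).
- by rewrite -fmorph_div fmorph_primitive_root.
Qed.

(** The second root tr M - a also lies in [k], so it must equal a. *)
Lemma nroots1_tr_det (M : 'M[k]_2) a : root (char_poly M) a -> nroots_mx M = 1%N ->
  \tr M = a *+ 2 /\ \det M = a ^+ 2.
Proof.
move=> ra; rewrite nroots_mxE => /eqP/cards1P[b bE].
have mem_roots x : root (char_poly M) x -> x = b.
  by move=> rx; apply/set1P; rewrite -bE inE.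
have r' : root (char_poly M) (\tr M - a).
  by move: ra; rewrite !char_poly2_root => /eqP <-; apply/eqP; ring.
have trE : \tr M = a *+ 2.
  by rewrite -(subrK a (\tr M)) (mem_roots _ r') -(mem_roots _ ra) mulr2n.
split => //; move: ra; rewrite char_poly2_root trE addrC addr_eq0 => /eqP ->; ring.
Qed.

Lemma fixed_count_unipotent g p n : p \in [pchar k] -> mx_type TypeB (GLval g) ->
  fixed_count g n = fps_mul (fps_poly (1 + 'X)) (fps_dil p (fV frob [set: K]%classic)) n.
Proof.
move=> pk /andP[/eqP r1 nsc].
have /card_gt0P[a] : (0 < #|[set a | root (char_poly (GLval g)) a]|)%N.
  by rewrite -nroots_mxE r1.
rewrite inE => ra; have a0 := GL_root_neq0 ra.
have [trE detE] := nroots1_tr_det ra r1.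
have [v [w [vw gv gw]]] := char_poly2_unipotent a0 trE detE nsc.
apply: (fps_stable_unipotent (l := iota a) (frame_map vw) (map_frob_iota _ _) (map_frob_iota _ _)).
- by rewrite fmorph_eq0.
- exact: map_mx_eigen.
- by rewrite (map_mx_eigen gw) map_mxD.
- by rewrite (fmorph_pchar iota).
Qed.

Lemma fixed_count_scalar g n : is_scalar_mx (GLval g) ->
  fixed_count g n = fV frobP1 [set: P1 K]%classic n.
Proof.
move=> /is_scalar_mxP[a gE]; rewrite /fV rational_subsetsE.
congr (Defs.card (stable_subsets _ _ _ _))%:R; apply/funext => x.
have [v v0 ->] := pt_surj x.
rewrite pt_GL2_act // gE map_scalar_mx mul_scalar_mx pt_scale // fmorph_eq0.
have : GLval g \in unitmx by exact: (valP g).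
by rewrite gE unitmxE det_scalar unitfE expf_eq0.
Qed.

Definition rootK g l := l ^+ 2 - iota (\tr (GLval g)) * l + iota (\det (GLval g)) == 0.

Lemma rootK_char_poly g l : rootK g l = root (char_poly (map_mx iota (GLval g))) l.
Proof. by rewrite char_poly2_root trace_map_mx det_map_mx. Qed.

Lemma rootK_iota g a : rootK g (iota a) = root (char_poly (GLval g)) a.
Proof.
by rewrite char_poly2_root -(fmorph_eq0 iota) rmorphD rmorphB !rmorphM.
Qed.

Lemma rootK_frob g l : rootK g (frob l) = rootK g l.
Proof.
rewrite /rootK -[RHS](frob_eq0 k) !(frobD iota) (frobN iota).
by rewrite !expr2 !frobM !frob_iota.
Qed.

(** An eigenvalue outside [k] brings its conjugate along, and the two together determine trace and
    determinant. *)
Lemma rootK_tr_det g l t m : l != frob l -> l + frob l = iota t -> l * frob l = iota m ->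
  rootK g l = (\tr (GLval g) == t) && (\det (GLval g) == m).
Proof.
move=> ll tE mE; rewrite -(inj_eq (fmorph_inj iota)) -[X in _ && X](inj_eq (fmorph_inj iota)).
rewrite -tE -mE -trace_map_mx -det_map_mx -char_poly2_tr_det // -!rootK_char_poly.
by rewrite rootK_frob andbb.
Qed.

Lemma rootK_cases g l x : l != frob l -> rootK g l -> rootK g x -> x = l \/ x = frob l.
Proof.
move=> ll rl; have : rootK g l && rootK g (frob l) by rewrite rootK_frob rl.
rewrite !rootK_char_poly char_poly2_tr_det // char_poly2_root => /andP[/eqP -> /eqP ->].
rewrite (_ : _ + _ = (x - l) * (x - frob l)); last by ring.
by rewrite mulf_eq0 !subr_eq0 => /orP[] /eqP; [left|right].
Qed.

(** The explicit eigenvectors for [l] and [frob l] are exchanged by Frobenius, as the non-split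
    frame requires. *)
Lemma fixed_count_nonsplit g l d n : l != frob l -> rootK g l ->
  d.-primitive_root (frob l / l) -> fixed_count g n = nonsplit_series d n.
Proof.
move=> ll rl prim; pose M := GLval g.
have l0 : l != 0 by apply: contra ll => /eqP ->; rewrite frob0.
pose ev x : 'cV[K]_2 := \col_i (if i == 0 then x - iota (M 1 1) else iota (M 1 0)).
have evE x : rootK g x -> map_mx iota M *m ev x = x *: ev x.
  rewrite rootK_char_poly => /char_poly2_explicit_eigenvector; rewrite !mxE.
  exact.
have frob_ev x : map_mx frob (ev x) = ev (frob x).
  by apply: colP2; rewrite !mxE /= ?(frobD iota, frobN iota) frob_iota.
(* If this entry vanished, the matrix would be triangular with the rational eigenvalue [M 1 1], but
   its eigenvalues are [l] and [frob l]. *)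
have c0 : M 1 0 != 0.
  apply/negP => /eqP c0; move: (rl); have : rootK g (iota (M 1 1)).
    by rewrite rootK_iota char_poly2_root mxtrace2 det2 -/M c0; apply/eqP; ring.
  move=> r1 _; have [] := rootK_cases ll rl r1 => E.
    by move: ll; rewrite -E frob_iota eqxx.
  by move: ll; rewrite -(inj_eq (frob_inj iota)) -E frob_iota eqxx.
have fl : rootK g (frob l) by rewrite rootK_frob.
have ffl : frob (frob l) = l.
  have : rootK g (frob (frob l)) by rewrite !rootK_frob.
  case/(rootK_cases ll rl) => // /(frob_inj iota) E.
  by rewrite E eqxx in ll.
have fr : frame (ev (frob l)) (ev l).
  rewrite /frame !mxE /=.
  rewrite [X in X != 0](_ : _ = iota (M 1 0) * (frob l - l)); last by rewrite /M; ring.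
  by rewrite mulf_neq0 ?fmorph_eq0 // subr_eq0 eq_sym.
have f1 : map_mx frob (ev (frob l)) = ev l by rewrite frob_ev ffl.
exact: (fps_stable_nonsplit fr f1 (frob_ev l) n l0 (evE _ fl) (evE _ rl) prim).
Qed.

End FixedCounts.

(** * Sums over the matrices of each type *)

Section TypeSums.
Variables (k : finFieldType) (K : closedFieldType) (iota : {rmorphism k -> K}).
Notation q := #|k|.
Notation frob := (@frob k K).
Notation frobP1 := (@frobP1 k K).
Implicit Types (g : {'GL_2[k]}) (n d : nat).

Lemma card_pchar0 : q%:R = 0 :> K.
Proof.
have [p _ pk] := finPcharP k; have pK : p \in [pchar K] by rewrite (fmorph_pchar iota).
have /abelem_pgroup := fin_ring_pchar_abelem pk; rewrite /pgroup cardsT => /p_natP[[|e] qE].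
  by have := finNzRing_gt1 k; rewrite qE.
by apply/eqP; rewrite -(dvdn_pcharf pK) qE expnS dvdn_mulr.
Qed.

Lemma q_gt0 : (0 < q)%N. Proof. exact: ltnW (finNzRing_gt1 k). Qed.
Lemma q1_gt0 : (0 < q.-1)%N. Proof. by rewrite -ltnS prednK ?q_gt0 ?finNzRing_gt1. Qed.

(** A primitive (q-1)-th root of unity in [K] satisfies z^q = z, so it comes from [k]. *)
Lemma prim_root_q1 : exists y : k, q.-1.-primitive_root y.
Proof.
have : q.-1%:R != 0 :> K.
  by rewrite -subn1 natrB ?q_gt0 // card_pchar0 sub0r oppr_eq0 oner_eq0.
case/closed_field_prim_root => z prim.
have [y yE] : exists y, z = iota y.
  apply: (frob_fixed (k := k)).
  by rewrite /frob -(prednK q_gt0) exprS (prim_expr_order prim) mulr1.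
by exists y; rewrite yE fmorph_primitive_root in prim.
Qed.

Lemma sum_type_split n :
  2 * \sum_(g : {'GL_2[k]} | mx_type TypeC (GLval g)) fixed_count iota g n =
  (q * q.+1)%:R * (q.-1)%:R *
  \sum_(d <- divisors q.-1 | (1 < d)%N) (totient d)%:R * split_series k K d n.
Proof.
have [y prim] := prim_root_q1; have q1 := q1_gt0.
have y0 : y != 0 by rewrite (prim_root_eq0 prim) -lt0n.
(* [(b, i)] stands for the ordered pair of eigenvalues [(b, b y^i)]. *)
pose Q (j : k * 'I_q.-1) := (j.1 != 0) && ~~ (q.-1 %| j.2)%N.
pose R g (j : k * 'I_q.-1) := [&& Q j, root (char_poly (GLval g)) j.1 &
  root (char_poly (GLval g)) (j.1 * y ^+ j.2)].
pose h (j : k * 'I_q.-1) := split_series k K (q.-1 %/ gcdn j.2 q.-1) n.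
have y1 (i : nat) : (y ^+ i == 1) = (q.-1 %| i)%N by rewrite (prim_order_dvd prim).
have Qneq j : Q j -> j.1 * y ^+ j.2 != j.1.
  move=> /andP[j0 ji]; rewrite -subr_eq0 -{2}[j.1]mulr1 -mulrBr mulf_eq0 subr_eq0 y1.
  by rewrite (negPf j0).
have := @double_count _ _ (fun g => mx_type TypeC (GLval g)) Q R
  (fun g => fixed_count iota g n) h (q * q.+1) 2.
rewrite -mulrA => ->; first 1 last.
- move=> g j; apply/andP/andP => -[_ Rgj]; split => //; first by case/and3P: Rgj.
  case/and3P: (Rgj) => Qj r1 r2; rewrite /= nroots_mxE.
  have -> : [set a | root (char_poly (GLval g)) a] = [set j.1; j.1 * y ^+ j.2].
    apply/setP => x; rewrite !inE.
    have := char_poly2_tr_det (GLval g) (Qneq j Qj); rewrite r1 r2 => /esym/andP[/eqP tE /eqP dE].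
    rewrite char_poly2_root tE dE (_ : _ + _ = (x - j.1) * (x - j.1 * y ^+ j.2)); last by ring.
    by rewrite mulf_eq0 !subr_eq0.
  by have := Qneq j Qj; rewrite cards2 eq_sym => ->.
(* Two indices per matrix: the two orders of its eigenvalues [a] and [b]. *)
- move=> g /=; rewrite nroots_mxE => /cards2P[a [b [ab E]]].
  have rE x : root (char_poly (GLval g)) x = (x == a) || (x == b).
    by have /setP/(_ x) := E; rewrite !inE.
  have ra : root (char_poly (GLval g)) a by rewrite rE eqxx.
  have rb : root (char_poly (GLval g)) b by rewrite rE eqxx orbT.
  have ratio c c' : c != 0 -> c' != 0 -> exists i : 'I_q.-1, c' = c * y ^+ i.
    move=> c0 c'0; have : (c' / c) ^+ q.-1 = 1.
      have u : c' / c != 0 by rewrite mulf_neq0 ?invr_eq0.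
      by apply: (mulfI u); rewrite -exprS prednK ?q_gt0 // expf_card mulr1.
    by case/(prim_rootP prim) => i iE; exists i; rewrite -iE mulrC divfK.
  have a0 := GL_root_neq0 ra; have b0 := GL_root_neq0 rb.
  have [i bE] := ratio a b a0 b0; have [i' aE] := ratio b a b0 a0.
  have yI (c : k) (u v : 'I_q.-1) : c != 0 -> c * y ^+ u = c * y ^+ v -> u = v.
    move=> c0 /(mulfI c0)/eqP; rewrite (eq_prim_root_expr prim) !modn_small //.
    by move=> /eqP E'; exact: val_inj.
  have Qab (u : 'I_q.-1) c : c != 0 -> c * y ^+ u != c -> Q (c, u).
    move=> c0 cu; rewrite /Q c0 /= -y1; apply: contra cu => /eqP ->; by rewrite mulr1.
  have -> : [set j | Q j && R g j] = [set (a, i); (b, i')].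
    apply/setP => -[c u]; rewrite !inE /R andbA andbb /= !rE !xpair_eqE.
    apply/idP/idP; last first.
      case/orP => /andP[/eqP -> /eqP ->].
        by rewrite -bE !eqxx orbT Qab // -bE eq_sym.
      by rewrite -aE !eqxx orbT Qab // -aE.
    case/and3P => Qcu; have := Qneq _ Qcu; rewrite /= => ne /orP[]/eqP cE; rewrite cE in ne *.
      rewrite (negPf ne) /= => /eqP E'; apply/orP; left; rewrite eqxx.
      by apply/eqP/(yI a) => //; rewrite -bE.
    rewrite (negPf ne) orbF => /eqP E'; apply/orP; right; rewrite eqxx.
    by apply/eqP/(yI b) => //; rewrite -aE.
  by rewrite cards2 xpair_eqE (negPf ab).
(* Here [nroots] is 2, and q(q-1) + 2q = q(q+1) matrices share the pair. *)
- move=> j Qj; have ne := Qneq j Qj; have /andP[j0 _] := Qj.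
  set b := j.1 in j0 ne *; pose a := b * y ^+ j.2.
  have ba : b != a by rewrite eq_sym.
  rewrite (eq_card (B := mem [set g : {'GL_2[k]} |
      (\tr (GLval g) == b + a) && (\det (GLval g) == b * a)])).
    rewrite card_GL_tr_det; last by rewrite !mulf_neq0 // expf_neq0.
    suff -> : nroots (b + a) (b * a) = 2%N by rewrite [(2 * q)%N]mulnC -mulnDr addn2 prednK ?q_gt0.
    rewrite /nroots (_ : [set x | _] = [set b; a]) ?cards2 ?ba //.
    apply/setP => x; rewrite !inE (_ : _ + _ = (x - b) * (x - a)); last by ring.
    by rewrite mulf_eq0 !subr_eq0.
  by move=> g; rewrite !inE /R Qj /= char_poly2_tr_det.
- move=> g j Qj /and3P[_ r1 r2]; apply: (fixed_count_split iota _ (Qneq j Qj) r2 r1).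
  have /andP[j0 _] := Qj.
  by rewrite mulrAC divff // mul1r; exact: exp_prim_root.
congr (_ * _); rewrite /Q /h.
(* The series depends on the ratio y^i only, so the sum over b contributes the factor q - 1. *)
rewrite -(pair_big_dep (fun b => b != 0) (fun _ (i : 'I_q.-1) => ~~ (q.-1 %| i)%N)
  (fun _ i => split_series k K (q.-1 %/ gcdn i q.-1) n)) /=.
rewrite sumr_const (cardC1 (0 : k)) -(sum_order_totient _ q1) mulr_natl //.
Qed.

Lemma sum_type_nonsplit n :
  2 * \sum_(g : {'GL_2[k]} | mx_type TypeA (GLval g)) fixed_count iota g n =
  (q * q.-1)%:R * (q.-1)%:R *
  \sum_(d <- divisors q.+1 | (1 < d)%N) (totient d)%:R * nonsplit_series k K d n.
Proof.
have q1 := q1_gt0; have q0 := q_gt0; set N := (q.-1 * q.+1)%N.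
have NE : N.+1 = (q * q)%N by rewrite /N -{1 3 4}(prednK q0) mulnS mulSn; lia.
(* In [K] the number q^2 - 1 equals -1, hence is invertible. *)
have [z prim] : exists z : K, N.-primitive_root z.
  apply: closed_field_prim_root.
  rewrite -[N]/(N.+1.-1) NE -subn1 natrB ?muln_gt0 ?q0 //.
  by rewrite natrM card_pchar0 mulr0 sub0r oppr_eq0 oner_eq0.
(* The ratio of conjugate eigenvalues [frob l / l] for l = z^j is the j-th power of this root,
   whence the order (q+1) / gcd(j, q+1). *)
have prim' : q.+1.-primitive_root (z ^+ q.-1).
  by have := dvdn_prim_root prim (dvdn_mull q.-1 (dvdnn q.+1)); rewrite mulnK.
have z0 : z != 0 by rewrite (prim_root_eq0 prim) -lt0n muln_gt0 q1.
have frobE l : l != 0 -> frob l / l = l ^+ q.-1.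
  by move=> l0; rewrite /frob -{1}(prednK q0) exprSr mulfK.
(* [j] stands for the eigenvalue [z^j], which is not in [k] iff [q+1] does not
   divide [j]. *)
pose Q (j : 'I_N) := ~~ (q.+1 %| j)%N.
pose h (j : 'I_N) := nonsplit_series k K (q.+1 %/ gcdn j q.+1) n.
have QE j : Q j = (z ^+ j != frob (z ^+ j)).
  have zj0 : z ^+ j != 0 by rewrite expf_neq0.
  rewrite /Q (prim_order_dvd prim') -exprM mulnC exprM -frobE // eq_sym.
  by rewrite eq_sym (can2_eq (divfK zj0) (mulfK zj0)) mul1r eq_sym.
have := @double_count _ _ (fun g => mx_type TypeA (GLval g)) Q
  (fun g j => rootK iota g (z ^+ j)) (fun g => fixed_count iota g n) h (q * q.-1) 2.
rewrite -mulrA => ->; first 1 last.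
- move=> g j; rewrite QE /= nroots_mxE.
  apply/andP/andP => -[H rj]; split => //.
    apply/negP => /eqP /esym /(frob_fixed iota) [b bE].
    move: H; rewrite cards_eq0 => /eqP/setP/(_ b).
    by rewrite !inE -(rootK_iota iota) -bE rj.
  rewrite cards_eq0; apply/eqP/setP => b; rewrite !inE; apply/negP.
  rewrite -(rootK_iota iota) => /(rootK_cases H rj) [E|E].
    by move: H; rewrite -E frob_iota eqxx.
  by move: H; rewrite -(inj_eq (frob_inj iota)) -E frob_iota eqxx.
- move=> g gA; have [l rl] : exists l, rootK iota g l.
    have /closed_rootP[l rl] : size (char_poly (map_mx iota (GLval g))) != 1%N.
      by rewrite size_char_poly.
    by exists l; rewrite rootK_char_poly.
  have nonrat x : rootK iota g x -> x != frob x.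
    move=> rx; apply/negP => /eqP /esym /(frob_fixed iota) [b bE].
    move: gA; rewrite /= nroots_mxE cards_eq0 => /eqP/setP/(_ b).
    by rewrite !inE -(rootK_iota iota) -bE rx.
  have ll := nonrat l rl; have rf : rootK iota g (frob l) by rewrite rootK_frob.
  (* The square of Frobenius fixes every eigenvalue, so x^(q^2) = x and x is an N-th root of
     unity. *)
  have pow x : rootK iota g x -> exists i : 'I_N, x = z ^+ i.
    move=> rx; have x0 : x != 0 by apply: contra (nonrat x rx) => /eqP ->; rewrite frob0.
    have ffx : frob (frob x) = x.
      have : rootK iota g (frob (frob x)) by rewrite !rootK_frob.
      case/(rootK_cases (nonrat x rx) rx) => // /(frob_inj iota) E.
      by have := nonrat x rx; rewrite E eqxx.
    have xN : x ^+ N = 1.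
      by apply: (mulfI x0); rewrite -exprS NE exprM mulr1.
    by case: (prim_rootP prim xN) => i ->; exists i.
  have [i iE] := pow l rl; have [i' i'E] := pow _ rf.
  have -> : [set j | Q j && rootK iota g (z ^+ j)] = [set i; i'].
    apply/setP => j; rewrite !inE QE; apply/andP/orP => [[_ rj]|].
      have zI (u : 'I_N) : z ^+ j = z ^+ u -> j == u.
        by move/eqP; rewrite (eq_prim_root_expr prim) !modn_small.
      case: (rootK_cases ll rl rj) => E; [left|right]; apply: zI; rewrite E //.
    by case=> /eqP ->; rewrite -?iE -?i'E; split => //; exact: nonrat.
  rewrite cards2; suff -> : i != i' by [].
  by apply: contra ll => /eqP E; rewrite i'E -E -iE.
- move=> j Qj; rewrite QE in Qj; set l := z ^+ j in Qj *.
  have ffl : frob (frob l) = l.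
    rewrite /frob -exprM -NE exprSr /l exprAC (prim_expr_order prim) expr1n mul1r //.
  (* The sum and product of conjugates are fixed by Frobenius, so they are a trace and a determinant
     over [k]. *)
  have [t tE] : exists t, l + frob l = iota t.
    by apply: (frob_fixed (k := k)); rewrite (frobD iota) ffl addrC.
  have [m mE] : exists m, l * frob l = iota m.
    by apply: (frob_fixed (k := k)); rewrite frobM ffl mulrC.
  have l0 : l != 0 by rewrite expf_neq0.
  have m0 : m != 0.
    by rewrite -(fmorph_eq0 iota) -mE mulf_neq0 // frob_eq0.
  rewrite (eq_card (B := mem [set g : {'GL_2[k]} | (\tr (GLval g) == t) && (\det (GLval g) == m)])).
    (* The roots [l] and [frob l] are outside [k], so the root count is 0 and q(q-1) matrices
       remain. *)
    rewrite card_GL_tr_det // (_ : nroots t m = 0%N) ?mul0n ?addn0 //.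
    apply/eqP; rewrite cards_eq0; apply/eqP/setP => b; rewrite !inE.
    rewrite -(fmorph_eq0 iota) rmorphD rmorphB rmorphXn rmorphM /= -tE -mE.
    rewrite [X in X == 0](_ : _ = (iota b - l) * (iota b - frob l)); last by ring.
    rewrite mulf_eq0 !subr_eq0; apply/negP => /orP[]/eqP E.
      by move: Qj; rewrite -E frob_iota eqxx.
    by move: Qj; rewrite -(inj_eq (frob_inj iota)) -E frob_iota eqxx.
  by move=> g; rewrite !inE (rootK_tr_det _ Qj tE mE).
- move=> g j Qj rj; rewrite QE in Qj; apply: (fixed_count_nonsplit _ Qj rj).
  rewrite frobE ?expf_neq0 // -exprM mulnC exprM.
  exact: exp_prim_root.
congr (_ * _); rewrite /Q /h.
exact: (sum_order_totient_mul (fun d => nonsplit_series k K d n)).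
Qed.

(** For each nonzero a, trace 2a and determinant a^2 leave q(q-1) + q = q^2 matrices; removing the
    scalar one gives (q-1)(q+1). *)
Lemma sum_type_unipotent p n : p \in [pchar k] ->
  \sum_(g : {'GL_2[k]} | mx_type TypeB (GLval g)) fixed_count iota g n =
  (q.-1 * q.+1)%:R * (q.-1)%:R *
  fps_mul (fps_poly (1 + 'X)) (fps_dil p (fV frob [set: K]%classic)) n.
Proof.
move=> pk; have q1 := q1_gt0; have q0 := q_gt0.
set h := fps_mul _ _ n.
pose R g (a : k) := mx_type TypeB (GLval g) && root (char_poly (GLval g)) a.
have := @double_count _ _ (fun g => mx_type TypeB (GLval g)) (fun a : k => a != 0) R
  (fun g => fixed_count iota g n) (fun=> h) (q.-1 * q.+1) 1.
rewrite mul1r -mulrA => ->; first 1 last.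
- move=> g a; rewrite /R andbA andbb; case: mx_type => //=; last by rewrite andbF.
  by case ra: root; rewrite ?andbF // (GL_root_neq0 ra).
- move=> g gB; have /andP[/eqP r1 _] := gB; rewrite -r1 nroots_mxE; apply: eq_card => a.
  by rewrite !inE /R gB /=; case ra: root; rewrite ?andbF // (GL_root_neq0 ra).
- move=> a a0; have arith (m r s : nat) : m = r.+1 -> (m * r + m = 1 + s -> s = r * m.+1)%N.
    by move=> ->; lia.
  have aU : a%:M \in @unitmx k 2 by rewrite unitmxE det_scalar unitfE expf_neq0.
  pose ga : {'GL_2[k]} := Sub (a%:M : 'M[k]_2) aU.
  have gaE : GLval ga = a%:M by exact: SubK.
  have nr : nroots (a *+ 2) (a ^+ 2) = 1%N.
    rewrite /nroots (_ : [set x | _] = [set a]) ?cards1 //.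
    apply/setP => x; rewrite !inE (_ : _ + _ = (x - a) ^+ 2); last by ring.
    by rewrite expf_eq0 subr_eq0.
  have trga : (\tr (GLval ga) == a *+ 2) && (\det (GLval ga) == a ^+ 2).
    by rewrite gaE mxtrace_scalar det_scalar !eqxx.
  pose D := [set g : {'GL_2[k]} | (\tr (GLval g) == a *+ 2) && (\det (GLval g) == a ^+ 2)].
  rewrite (eq_card (B := mem (D :\ ga))).
    have := cardsD1 ga D.
    rewrite card_GL_tr_det ?expf_neq0 // nr inE trga mul1n => E.
    by apply: arith E; rewrite prednK.
  move=> g; rewrite !inE /R /=.
  apply/idP/andP => [/andP[/andP[/eqP r1 nsc] ra]|[ga' /andP[/eqP tE /eqP dE]]].
    have [-> ->] := nroots1_tr_det ra r1; rewrite !eqxx; split => //.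
    by apply: contra nsc => /eqP ->; rewrite gaE scalar_mx_is_scalar.
  rewrite /nroots_mx char_poly2_root tE dE nr eqxx /=; apply/andP; split.
    apply: contra ga' => /is_scalar_mxP[c cE]; apply/eqP/val_inj; rewrite /= cE.
    have : c ^+ 2 - a *+ 2 * c + a ^+ 2 == 0.
      by rewrite -tE -dE cE mxtrace_scalar det_scalar; apply/eqP; ring.
    rewrite (_ : _ + _ = (c - a) ^+ 2); last by ring.
    by rewrite expf_eq0 subr_eq0 => /eqP ->.
  by apply/eqP; ring.
- by move=> g a _ /andP[gB _]; exact: fixed_count_unipotent.
by congr (_ * _); rewrite sumr_const (cardC1 (0 : k)) mulr_natl.
Qed.

Lemma sum_type_scalar n :
  \sum_(g : {'GL_2[k]} | mx_type TypeD (GLval g)) fixed_count iota g n =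
  (q.-1)%:R * fV frobP1 [set: P1 K]%classic n.
Proof.
rewrite (eq_bigr (fun=> fV frobP1 [set: P1 K]%classic n)) => [|g gD]; last first.
  exact: fixed_count_scalar.
rewrite sumr_const mulr_natl; congr (_ *+ _).
pose f (g : {'GL_2[k]}) : k := GLval g 0 0.
transitivity #|f @: [set g : {'GL_2[k]} | is_scalar_mx (GLval g)]|.
  rewrite card_in_imset => [|g h]; first by apply: eq_card => g; rewrite inE.
  rewrite !inE => /is_scalar_mxP[a gE] /is_scalar_mxP[b hE]; rewrite /f gE hE !mxE => ab.
  by apply/val_inj; rewrite /= gE hE; congr _%:M.
rewrite -(cardC1 (0 : k)); apply: eq_card => a; rewrite [RHS]inE /=.
apply/imsetP/idP => [[g]|a0].
  rewrite inE => /is_scalar_mxP[b gE] ->.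
  have := GL_root_neq0 (g := g) (a := b); rewrite /f gE mxE mulr1n; apply.
  by rewrite char_poly2_root mxtrace_scalar det_scalar; apply/eqP; ring.
have aU : a%:M \in @unitmx k 2 by rewrite unitmxE det_scalar unitfE expf_neq0.
exists (Sub (a%:M : 'M[k]_2) aU); first by rewrite inE SubK scalar_mx_is_scalar.
by rewrite /f SubK mxE mulr1n.
Qed.

End TypeSums.

(** * Burnside's lemma *)

Lemma coset_conj (gT : finGroupType) (A : {set gT}) (x y : gT) :
  x \in 'N(A)%g -> y \in 'N(A)%g -> (coset A x ^ coset A y = coset A (x ^ y))%g.
Proof. by move=> xA yA; rewrite morphJ. Qed.

Section Group.
Variables (k : finFieldType) (K : closedFieldType) (iota : {rmorphism k -> K}).
Notation q := #|k|.
Notation frobP1 := (@frobP1 k K).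
Implicit Types (g h : {'GL_2[k]}) (n : nat) (x y : PGL2T k).

Lemma PGL2_cosetP x : exists g, x = coset (scalars k) g.
Proof. by have [g _ ->] := cosetP x; exists g. Qed.

Lemma mx_type_scale T c (M : 'M[k]_2) : c != 0 -> mx_type T (c *: M) = mx_type T M.
Proof.
move=> c0; have nE : nroots_mx (c *: M) = nroots_mx M.
  have cI : injective ( *%R c) := mulfI c0.
  rewrite !nroots_mxE -[RHS](card_imset _ cI); apply: eq_card => b; rewrite inE.
  have bE : b = c * (b / c) by rewrite mulrC divfK.
  rewrite bE (mem_imset _ _ cI) inE !char_poly2_root mxtraceZ detZ.
  have c2 : c ^+ 2 != 0 by rewrite expf_neq0.
  rewrite -[RHS]orFb -(negPf c2) -mulf_eq0.
  by congr (_ == 0); ring.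
have sE : is_scalar_mx (c *: M) = is_scalar_mx M.
  apply/is_scalar_mxP/is_scalar_mxP => -[a aE].
    by exists (c^-1 * a); rewrite -scale_scalar_mx -aE scalerA mulVf // scale1r.
  by exists (c * a); rewrite aE scale_scalar_mx.
by case: T; rewrite /mx_type ?nE ?sE.
Qed.

Lemma mx_type_conj T g h : mx_type T (GLval (g ^ h)%g) = mx_type T (GLval g).
Proof.
have E : GLval (g ^ h)%g = invmx (GLval h) *m (GLval g *m GLval h).
  by rewrite conjgE !GL_ME.
have hU : GLval h \in unitmx by exact: (valP h).
have trE : \tr (GLval (g ^ h)%g) = \tr (GLval g) by rewrite E mxtrace_mulC mulmxK.
have detE : \det (GLval (g ^ h)%g) = \det (GLval g).
  by rewrite E det_mulmx mulrC -det_mulmx mulmxK.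
have sE : is_scalar_mx (GLval (g ^ h)%g) = is_scalar_mx (GLval g).
  apply/is_scalar_mxP/is_scalar_mxP => -[a aE]; exists a.
    have : GLval h *m GLval (g ^ h)%g = GLval g *m GLval h by rewrite E mulKVmx.
    by rewrite aE scalar_mxC => /(can_inj (mulmxK hU)).
  by rewrite E aE -scalar_mxC mulKmx.
by case: T; rewrite /mx_type /nroots_mx ?trE ?detE ?sE.
Qed.

(** Two representatives differ by a nonzero scalar, which rescales the eigenvalues without changing
    their number, so any representing matrix decides the type. *)
Lemma has_type_coset T g : has_type T (coset (scalars k) g) <-> mx_type T (GLval g).
Proof.
split=> [[h hg /mx_has_typeP hT]|gT]; last by exists g => //; apply/mx_has_typeP.
have /rcosetP[s] : h \in (scalars k :* g)%g.
  by rewrite -val_coset ?norm_scalars // -hg val_coset ?norm_scalars // rcoset_refl.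
rewrite inE => /is_scalar_mxP[c cE] hE; move: hT.
rewrite hE GL_ME cE -mulmxE mul_scalar_mx mx_type_scale //.
have : GLval s \in unitmx by exact: (valP s).
by rewrite cE unitmxE det_scalar unitfE expf_eq0.
Qed.

Definition pgl_fixed_count x n : rat :=
  (Defs.card [set S | rational_nsets k n S /\ PGL2_image iota x S = S]%classic)%:R.

Lemma pgl_fixed_count_coset g n :
  pgl_fixed_count (coset (scalars k) g) n = fixed_count iota g n.
Proof.
rewrite /pgl_fixed_count /fixed_count; congr (Defs.card _)%:R.
rewrite -[LHS]/(stable_subsets frobP1 (PGL2_act iota (coset (scalars k) g)) [set: P1 K]%classic n).
by congr stable_subsets; apply/funext => a; rewrite PGL2_act_coset.
Qed.

Lemma frobP1_GL2_act g (a : P1 K) : frobP1 (GL2_act iota g a) = GL2_act iota g (frobP1 a).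
Proof.
have [v v0 ->] := pt_surj a.
rewrite (pt_GL2_act _ _ v0) (pt_frobP1 _ (GL2_act_neq0 iota g v0)) (pt_frobP1 _ v0).
by rewrite (pt_GL2_act _ _ (frob_neq0 k v0)) (map_frob_mulmx iota) map_frob_iota.
Qed.

(** The matrix [h] carries the sets fixed by h^-1 g h to those fixed by g, and it preserves
    rationality because its entries lie in [k]. *)
Lemma fixed_count_conj g h n : fixed_count iota (g ^ h)%g n = fixed_count iota g n.
Proof.
congr (_%:R); apply: (card_stable_transport _ (e := GL2_act iota h)) => //.
- by move=> a b _ _; exact: GL2_act_inj.
- apply/seteqP; split => // a _; exists (GL2_act iota h^-1%g a) => //.
  by rewrite -GL2_actM mulgV GL2_act1.
- by move=> a _; rewrite frobP1_GL2_act.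
- by move=> a _; rewrite -!GL2_actM conjgE mulKVg.
Qed.

Lemma card_scalars_PGL2 : (#|scalars k| * #|PGL2 k|)%N = #|'GL_2[k]%g|.
Proof.
rewrite /PGL2 /= card_quotient; last by apply/fintype.subsetP => g _; exact: norm_scalars.
by rewrite Lagrange // finset.subsetT.
Qed.

Lemma normal_scalars : (scalars k <| 'GL_2[k])%g.
Proof.
by rewrite /normal finset.subsetT; apply/fintype.subsetP => g _; exact: norm_scalars.
Qed.

(** The centralizer weights turn the sum over representatives into an average over PGL_2(k), so [C]
    disappears; pulling back along GL_2(k) -> PGL_2(k) multiplies both the sum and the group order
    by the number of scalars. *)
Lemma t1T_sum (C : {set PGL2T k}) T n :
  is_transversal C (classes (PGL2 k)) (PGL2 k) ->
  t1T iota C T n = (#|'GL_2[k]%g|%:R)^-1 *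
    \sum_(g : {'GL_2[k]} | mx_type T (GLval g)) fixed_count iota g n.
Proof.
move=> hC; rewrite /t1T (sum_class_representatives (P := fun x => `[< has_type T x >])
  (F := pgl_fixed_count ^~ n) hC).
- have sc0 : (#|scalars k|%:R : rat) != 0.
    by rewrite Num.Theory.pnatr_eq0 -lt0n (cardG_gt0 (scalars_group k)).
  have := sum_quotient (fun x => `[< has_type T x >]) (pgl_fixed_count ^~ n) normal_scalars.
  rewrite (eq_big (fun g => mx_type T (GLval g)) (fun g => fixed_count iota g n)).
  - move=> ->; rewrite -card_scalars_PGL2 natrM invfM.
    by rewrite [_^-1 * _^-1]mulrC -mulrA mulKf.
  - by move=> g; rewrite inE /=; apply/asboolP/idP => /has_type_coset.
  - by move=> g _; exact: pgl_fixed_count_coset.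
- move=> x y _ _; have [g ->] := PGL2_cosetP x; have [h ->] := PGL2_cosetP y.
  rewrite (coset_conj (norm_scalars g) (norm_scalars h)).
  apply/asboolP/asboolP => /has_type_coset; rewrite ?mx_type_conj => gT.
    exact/has_type_coset.
  by apply/has_type_coset; rewrite mx_type_conj.
- move=> x y _ _; have [g ->] := PGL2_cosetP x; have [h ->] := PGL2_cosetP y.
  by rewrite (coset_conj (norm_scalars g) (norm_scalars h)) !pgl_fixed_count_coset fixed_count_conj.
Qed.

Lemma sum_types n :
  (#|PGL2 k|%:R)^-1 * (\sum_(x in PGL2 k) pgl_fixed_count x n) =
  (#|'GL_2[k]%g|%:R)^-1 * \sum_g fixed_count iota g n.
Proof.
have sc0 : (#|scalars k|%:R : rat) != 0.
  by rewrite Num.Theory.pnatr_eq0 -lt0n (cardG_gt0 (scalars_group k)).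
have := sum_quotient predT (pgl_fixed_count ^~ n) normal_scalars.
rewrite (eq_big predT (fun g => fixed_count iota g n)).
- move=> ->; rewrite -card_scalars_PGL2 natrM invfM [_^-1 * _^-1]mulrC -mulrA mulKf //.
  by congr (_ * _); apply: eq_bigl => x; rewrite andbT.
- by move=> g; rewrite inE.
- by move=> g _; exact: pgl_fixed_count_coset.
Qed.

Lemma PGL2_act1 (a : P1 K) : PGL2_act iota 1%g a = a.
Proof. by rewrite -(morph1 (coset_morphism (scalars k))) PGL2_act_coset GL2_act1. Qed.

Lemma PGL2_actM x y (a : P1 K) :
  PGL2_act iota (x * y)%g a = PGL2_act iota x (PGL2_act iota y a).
Proof.
have [g ->] := PGL2_cosetP x; have [h ->] := PGL2_cosetP y.
rewrite -(coset_morphM (norm_scalars g) (norm_scalars h)).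
by rewrite !PGL2_act_coset GL2_actM.
Qed.

Lemma PGL2_image1 (S : {fset P1 K}) : PGL2_image iota 1%g S = S.
Proof.
apply/fsetP => a; apply/imfsetP/idP => [[b /= bS ->]|aS]; first by rewrite PGL2_act1.
by exists a; rewrite ?PGL2_act1.
Qed.

Lemma PGL2_imageM x y (S : {fset P1 K}) :
  PGL2_image iota (x * y)%g S = PGL2_image iota x (PGL2_image iota y S).
Proof.
apply/fsetP => a; apply/imfsetP/imfsetP => [[b /= bS ->]|[_ /imfsetP[b /= bS ->] ->]].
  by exists (PGL2_act iota y b); rewrite ?in_imfset ?PGL2_actM.
by exists b; rewrite ?PGL2_actM.
Qed.

Lemma PGL2_image_rational x n (S : {fset P1 K}) :
  rational_nsets k n S -> rational_nsets k n (PGL2_image iota x S).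
Proof.
have [g ->] := PGL2_cosetP x => -[Sn _ Ss].
have imE : PGL2_image iota (coset (scalars k) g) S = [fset GL2_act iota g a | a in S]%fset.
  by apply: eq_imfset => // a; exact: PGL2_act_coset.
rewrite imE; split=> //.
  rewrite card_in_imfset // => a b _ _; exact: GL2_act_inj.
rewrite (imfset_intertwine (f := frobP1)) ?Ss // => a _.
by rewrite frobP1_GL2_act.
Qed.

Lemma card_finset (T : finType) (B : {set T}) : Defs.card [set` B]%classic = #|B|.
Proof.
have -> : [set` B]%classic = [set` [fset t in enum B]%fset]%classic.
  by apply/seteqP; split => t /=; rewrite in_fset /= mem_enum.
by rewrite /Defs.card set_fsetK cardE card_fseq undup_id // enum_uniq.
Qed.

(** There are finitely many rational n-sets, so they form a finite type on which the group acts and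
    the Frobenius-Cauchy formula applies. *)
Lemma t1_burnside n :
  (t1 iota n)%:R = (#|PGL2 k|%:R)^-1 * (\sum_(x in PGL2 k) pgl_fixed_count x n).
Proof.
pose X := fset_set (rational_nsets k (K := K) n).
have inX S : (S \in X) <-> rational_nsets k n S.
  by rewrite /X in_fset_set ?inE //; exact: finite_rational_nsets.
(* MathComp actions are on the right, hence the inverse. *)
pose to (S : X) x : X := insubd S (PGL2_image iota x^-1%g (val S)).
have toE S x : val (to S x) = PGL2_image iota x^-1%g (val S).
  by rewrite insubdK //; apply/inX/PGL2_image_rational/inX/valP.
have to1 : to^~ 1%g =1 id by move=> S; apply/val_inj; rewrite toE invg1 PGL2_image1.
have toM : forall S, act_morph to S by move=> S x y; apply/val_inj; rewrite !toE invMg PGL2_imageM.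
pose A := TotalAction to1 toM.
have actsT : [acts PGL2 k, on [set: X] | A].
  by apply/actsP => x _ S; rewrite !inE.
have := Frobenius_Cauchy actsT.
have -> : #|orbit A (PGL2 k) @: [set: X]| = t1 iota n.
  (* Forgetting membership in [X] matches the orbits of the action with the sets [PGL2_orbit]. *)
  pose Phi (B : {set X}) : set {fset P1 K} := [set val S | S in [set` B]]%classic.
  rewrite -card_finset; apply: (@card_bij _ _ Phi).
    move=> B1 B2 _ _ E; apply/setP => S.
    have memPhi (B : {set X}) : (S \in B) <-> Phi B (val S).
      by split=> [SB|[S' S'B /val_inj <-]//]; exists S.
    by apply/idP/idP => /memPhi; [rewrite E|rewrite -E] => /memPhi.
  have PhiE (S : X) : Phi (orbit A (PGL2 k) S) = PGL2_orbit iota (val S).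
    apply/seteqP; split=> [_ [S' /= /orbitP[x xG <-] <-]|_ [x xG ->]].
      by exists x^-1%g; rewrite ?groupV //= toE.
    exists (to S x^-1%g); last by rewrite toE invgK.
    by apply/orbitP; exists x^-1%g; rewrite ?groupV.
  apply/seteqP; split=> [_ [_ /imsetP[S _ ->] <-]|_ [S Sr ->]].
    by exists (val S); [exact/inX/valP|exact: PhiE].
  move/inX: Sr => SX; exists (orbit A (PGL2 k) [` SX]%fset); first exact: imset_f.
  exact: PhiE.
move=> burn; have G0 : (#|PGL2 k|%:R : rat) != 0.
  by rewrite Num.Theory.pnatr_eq0 -lt0n cardG_gt0.
apply: (mulfI G0); rewrite mulVKf // -natrM mulnC -burn natr_sum.
apply: eq_bigr => x _; rewrite /pgl_fixed_count -card_finset; congr (_%:R).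
apply: (@card_bij _ _ (fun S : X => val S)); first by move=> S S' _ _ /val_inj.
(* [A] acts through inverses, but a set is fixed by [x] exactly when it is fixed by the inverse of
   [x]. *)
apply/seteqP; split=> [_ [S /= SF <-]|S [/inX SX Sx]].
  split; first exact/inX/valP.
  move: SF; rewrite inE => /andP[_ /afix1P /(congr1 val)]; rewrite /= toE => E.
  by rewrite -{1}E -PGL2_imageM mulgV PGL2_image1.
exists [` SX]%fset => //=; rewrite inE finset.in_setT; apply/afix1P/val_inj.
by rewrite /= toE /= -{1}Sx -PGL2_imageM mulVg PGL2_image1.
Qed.

(** The four types partition the matrices: at most two roots are possible, and a scalar matrix has
    exactly one, so it occurs in type D only. *)
Lemma t1_split (C : {set PGL2T k}) n :
  is_transversal C (classes (PGL2 k)) (PGL2 k) ->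
  (t1 iota n)%:R = t1T iota C TypeA n + t1T iota C TypeB n
                   + t1T iota C TypeC n + t1T iota C TypeD n.
Proof.
move=> hC; rewrite t1_burnside sum_types !t1T_sum // -!mulrDr; congr (_ * _).
rewrite [X in _ = X + _ + _ + _]big_mkcond [X in _ = _ + X + _ + _]big_mkcond.
rewrite [X in _ = _ + _ + X + _]big_mkcond [X in _ = _ + _ + _ + X]big_mkcond -!big_split /=.
apply: eq_bigr => g _.
have sc : is_scalar_mx (GLval g) -> nroots_mx (GLval g) = 1%N.
  move=> /is_scalar_mxP[a aE]; rewrite nroots_mxE aE.
  apply/eqP/cards1P; exists a; apply/setP => x.
  rewrite !inE char_poly2_root mxtrace_scalar det_scalar -[RHS]subr_eq0.
  have <- : ((x - a) ^+ 2 == 0) = (x - a == 0) by rewrite expf_eq0.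
  by congr (_ == 0); ring.
have := nroots_mx_le2 (GLval g); case: is_scalar_mx sc => [/(_ isT) ->|_].
  by rewrite /= !add0r.
by case: nroots_mx => [|[|[|]]] //= _; rewrite ?add0r ?addr0.
Qed.

End Group.

(** * The four generating functions *)

Lemma fps_mul_sum (u : fps) (I : Type) (r : seq I) (P : pred I) (f : I -> fps) n :
  fps_mul u (\sum_(i <- r | P i) f i) n = \sum_(i <- r | P i) fps_mul u (f i) n.
Proof.
rewrite /fps_mul [RHS]exchange_big; apply: eq_bigr => j _.
by rewrite fct_sumE mulr_sumr.
Qed.

Lemma fps_mulZ (u f : fps) c n : fps_mul u (fps_scale c f) n = c * fps_mul u f n.
Proof.
by rewrite /fps_mul mulr_sumr; apply: eq_bigr => j _; rewrite /fps_scale mulrCA.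
Qed.

Theorem theorem5p2 (k : finFieldType) (p q : nat)
    (hp : p \in [pchar k]) (hq : #|k| = q)
    (K : closedFieldType) (iota : {rmorphism k -> K})
    (K_alg : forall x : K, algebraicOver iota x)
    (P : P1 K) (hP : degree k P = 2%N)
    (star : k)
    (C : {set PGL2T k}) (hC : is_transversal C (classes (PGL2 k)) (PGL2 k)) :
  (forall n : nat,
     (t1 iota n)%:R = t1T iota C TypeA n + t1T iota C TypeB n
                      + t1T iota C TypeC n + t1T iota C TypeD n) /\
  [/\ t1T iota C TypeA =
        fps_scale (2 * (q%:R + 1))^-1
          (fps_mul (fps_poly (1 + 'X^2))
            (\sum_(d <- divisors (q + 1) | (1 < d)%N)
               fps_scale (totient d)%:R
                 (fps_dil d (fV (@frobP1 k K) (~` frob_orbit k P)%classic)))),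
      t1T iota C TypeB =
        fps_scale q%:R^-1
          (fps_mul (fps_poly (1 + 'X))
            (fps_dil p (fV (@frob k K) [set: K]%classic))),
      t1T iota C TypeC =
        fps_scale (2 * (q%:R - 1))^-1
          (fps_mul (fps_poly ((1 + 'X) ^+ 2))
            (\sum_(d <- divisors (q - 1) | (1 < d)%N)
               fps_scale (totient d)%:R
                 (fps_dil d (fV (@frob k K) (~` [set iota star])%classic))))
    & t1T iota C TypeD =
        fps_scale (q%:R * (q%:R - 1) * (q%:R + 1))^-1
          (fV (@frobP1 k K) [set: P1 K]%classic)].
Proof.
have q1 := q1_gt0 k; have q0 := q_gt0 k; subst q.
have cardGL : (#|'GL_2[k]%g|%:R : rat) = #|k|%:R * (#|k|.-1%:R * #|k|.-1%:R) * #|k|.+1%:R.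
  by rewrite card_GL_2 !natrM.
have n0 m : (0 < m)%N -> (m%:R : rat) != 0 by rewrite Num.Theory.pnatr_eq0 -lt0n.
have [k0 k1 k2] : [/\ (#|k|%:R : rat) != 0, (#|k|.-1%:R : rat) != 0 & (#|k|.+1%:R : rat) != 0].
  by split; exact: n0.
have qB : (#|k|%:R - 1 : rat) = #|k|.-1%:R by rewrite -subn1 natrB.
have qD : (#|k|%:R + 1 : rat) = #|k|.+1%:R by rewrite natr1.
have two (x s : rat) : 2 * x = s -> x = s / 2 by move=> <-; rewrite mulrC mulKf.
split=> [n|]; first exact: t1_split.
split; apply/funext => n; rewrite t1T_sum // cardGL /fps_scale ?qB ?qD.
- rewrite (two _ _ (sum_type_nonsplit iota n)) natrM.
  have -> : fps_mul (fps_poly (1 + 'X^2)) (\sum_(d <- divisors (#|k| + 1) | (1 < d)%N)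
      fps_scale (totient d)%:R (fps_dil d (fV (@frobP1 k K) (~` frob_orbit k P)%classic))) n =
      \sum_(d <- divisors #|k|.+1 | (1 < d)%N) (totient d)%:R * nonsplit_series k K d n.
    rewrite fps_mul_sum addn1; apply: eq_bigr => d _.
    rewrite /nonsplit_series fps_mulZ; congr (_ * fps_mul _ (fps_dil _ _) n).
    (* The complement of the orbit of [P] has the series of K^* under z |-> z^-q, whichever point of
       degree two is given. *)
    by apply/funext => j; exact: (fV_degree2 iota).
  move: (\sum_(d <- _ | _) _) k0 k1 k2 => s.
  move: #|k|%:R #|k|.-1%:R #|k|.+1%:R => a b c a0 b0 c0.
  by field; rewrite a0 b0 c0.
- rewrite (sum_type_unipotent _ _ hp) natrM; move: (fps_mul _ _ _) k0 k1 k2 => s.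
  move: #|k|%:R #|k|.-1%:R #|k|.+1%:R => a b c a0 b0 c0.
  by field; rewrite a0 b0 c0.
- rewrite (two _ _ (sum_type_split iota n)) natrM subn1.
  have -> : fps_mul (fps_poly ((1 + 'X) ^+ 2)) (\sum_(d <- divisors #|k|.-1 | (1 < d)%N)
      fps_scale (totient d)%:R (fps_dil d (fV (@frob k K) (~` [set iota star])%classic))) n =
      \sum_(d <- divisors #|k|.-1 | (1 < d)%N) (totient d)%:R * split_series k K d n.
    rewrite fps_mul_sum; apply: eq_bigr => d _.
    rewrite /split_series fps_mulZ; congr (_ * fps_mul _ (fps_dil _ _) n).
    by apply/funext => j; exact: fV_punctured_line.
  move: (\sum_(d <- _ | _) _) k0 k1 k2 => s.
  move: #|k|%:R #|k|.-1%:R #|k|.+1%:R => a b c a0 b0 c0.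
  by field; rewrite a0 b0 c0.
- rewrite sum_type_scalar; move: (fV _ _ _) k0 k1 k2 => s.
  move: #|k|%:R #|k|.-1%:R #|k|.+1%:R => a b c a0 b0 c0.
  by field; rewrite a0 b0 c0.
Qed.
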